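(* Let $n\ge 2$. A functional $\Psi:\mathcal{P}^n_0 \to \mathbb{R}$ is an upper semicontinuous and $\mathrm{SL}(n)$ invariant valuation if and only if there are constants $c_0, c_n\in\mathbb{R}$ such that $$\Psi (P)= c_0\,V_0(P) +c_n\,V_n(P)$$ for every $P\in\mathcal{P}^n_0$.
   Context: $\mathcal{P}^n_0$ is the set of convex polytopes in $\mathbb{R}^n$ that contain the origin $0$, equipped with the topology induced by the Hausdorff metric (upper semicontinuity refers to this topology). A functional $\Psi:\mathcal{S}\to\mathbb{R}$ on a collection $\mathcal{S}$ of sets is a valuation if $\Psi(P)+\Psi(Q)=\Psi(P\cup Q)+\Psi(P\cap Q)$ whenever $P,Q,P\cap Q,P\cup Q\in\mathcal{S}$. It is $\mathrm{SL}(n)$ invariant if $\Psi(AP)=\Psi(P)$ for every $A\in\mathrm{SL}(n)$ (the real $n\times n$ matrices of determinant $1$) and $P\in\mathcal{S}$. $V_n$ is $n$-dimensional volume and $V_0$ is the Euler characteristic, i.e. $V_0(P)=1$ for every nonempty polytope $P$. *)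

(* Defs.v *)
From HB Require Import structures.
From mathcomp Require Import all_boot all_order all_algebra.
From mathcomp Require Import all_classical all_reals all_analysis.
From mathcomp Require Import ring lra.

Set Implicit Arguments.
Unset Strict Implicit.
Unset Printing Implicit Defensive.

Import Order.TTheory GRing.Theory Num.Theory.
Import numFieldNormedType.Exports.

Local Open Scope classical_set_scope.
Local Open Scope ring_scope.

Section euclidean_norm.
Context {R : realType} {n : nat}.
Implicit Types x y : 'cV[R]_n.

(* The library norm `|x| on matrices is the sup norm. *)
Definition enorm x : R := Num.sqrt (\sum_i x i ord0 ^+ 2).

Lemma enorm_ge0 x : 0 <= enorm x.
Proof. exact: sqrtr_ge0. Qed.

Lemma sumsq_ge0 (I : finType) (a : I -> R) : 0 <= \sum_i a i ^+ 2.
Proof. by apply: sumr_ge0 => i _; exact: sqr_ge0. Qed.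

Lemma enorm_sqr x : enorm x ^+ 2 = \sum_i x i ord0 ^+ 2.
Proof. by rewrite sqr_sqrtr// sumsq_ge0. Qed.

Lemma enorm0 : enorm 0 = 0.
Proof. by rewrite /enorm big1 ?sqrtr0// => i _; rewrite mxE expr0n. Qed.

Lemma enorm0_eq0 x : enorm x = 0 -> x = 0.
Proof.
move=> x0; have /eqP := enorm_sqr x; rewrite x0 expr0n/= eq_sym psumr_eq0; last first.
  by move=> i _; exact: sqr_ge0.
move=> /allP x0'; apply/colP => i; rewrite mxE.
by have := x0' i (mem_index_enum _); rewrite sqrf_eq0 => /eqP.
Qed.

Lemma enormZ (a : R) x : enorm (a *: x) = `|a| * enorm x.
Proof.
rewrite /enorm -sqrtr_sqr -sqrtrM ?sqr_ge0// mulr_sumr.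
by congr Num.sqrt; apply: eq_bigr => i _; rewrite mxE exprMn.
Qed.

Lemma enormN x : enorm (- x) = enorm x.
Proof. by rewrite -scaleN1r enormZ normrN1 mul1r. Qed.

Lemma cauchy_schwarz x y :
  \sum_i x i ord0 * y i ord0 <= enorm x * enorm y.
Proof.
pose D := \sum_i x i ord0 * y i ord0.
have : 0 <= enorm (enorm y ^+ 2 *: x - D *: y) ^+ 2 by exact: sqr_ge0.
rewrite enorm_sqr.
have -> : \sum_i (enorm y ^+ 2 *: x - D *: y) i ord0 ^+ 2 =
    enorm y ^+ 2 * (enorm x ^+ 2 * enorm y ^+ 2 - D ^+ 2).
  under eq_bigr => i _.
    rewrite (_ : _ ^+ 2 = enorm y ^+ 4 * x i ord0 ^+ 2
      + (- 2 * enorm y ^+ 2 * D) * (x i ord0 * y i ord0)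
      + D ^+ 2 * y i ord0 ^+ 2); last by rewrite !mxE; ring.
    over.
  rewrite !big_split/= -!mulr_sumr -!enorm_sqr -/D; ring.
have [/enorm0_eq0 -> _|y0] := eqVneq (enorm y) 0.
  by rewrite enorm0 mulr0 big1// => i _; rewrite mxE mulr0.
rewrite pmulr_rge0; last by rewrite exprn_gt0// lt_neqAle eq_sym y0 enorm_ge0.
rewrite subr_ge0 -exprMn => H; apply: le_trans (ler_norm _) _.
by rewrite -ler_sqr ?nnegrE ?normr_ge0 ?mulr_ge0 ?enorm_ge0// real_normK ?num_real.
Qed.

Lemma enormD x y : enorm (x + y) <= enorm x + enorm y.
Proof.
rewrite -ler_sqr ?nnegrE ?addr_ge0 ?enorm_ge0// enorm_sqr.
under eq_bigr do rewrite mxE sqrrD.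
rewrite !big_split/= sqrrD -!enorm_sqr lerD2r lerD2l mulr2n.
by apply: lerD; exact: cauchy_schwarz.
Qed.

End euclidean_norm.

Section polytopes.
Context {R : realType} {n : nat}.

Definition conv_hull k (v : 'I_k -> 'cV[R]_n) : set 'cV[R]_n :=
  [set x | exists w : 'I_k -> R,
    [/\ forall i, 0 <= w i, \sum_i w i = 1 & x = \sum_i w i *: v i]].

Definition is_polytope (P : set 'cV[R]_n) : Prop :=
  exists k (v : 'I_k -> 'cV[R]_n), P = conv_hull v.

End polytopes.

Record polytope0 (R : realType) (n : nat) := Polytope0 {
  polytope_set :> set 'cV[R]_n ;
  polytopeP : is_polytope polytope_set ;
  polytope_origin : polytope_set 0 }.

HB.instance Definition _ (R : realType) (n : nat) := gen_eqMixin (polytope0 R n).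
HB.instance Definition _ (R : realType) (n : nat) :=
  gen_choiceMixin (polytope0 R n).

Section hausdorff.
Context {R : realType} {n : nat}.
Implicit Types (P Q S : polytope0 R n) (A B C : set 'cV[R]_n).

Lemma polytope0_inj P Q : P = Q :> set _ -> P = Q.
Proof.
case: P Q => [P pP oP] [Q pQ oQ] /= PQ; subst Q.
by congr Polytope0; exact: Prop_irrelevance.
Qed.

(* [A] is contained in the closed [r]-neighbourhood of [B]. *)
Definition within (r : R) A B :=
  forall x, A x -> exists2 y, B y & enorm (x - y) <= r.

Definition hausdorff_radii A B : set R :=
  [set r | [/\ 0 <= r, within r A B & within r B A]].

Definition hausdorff_dist A B : R := inf (hausdorff_radii A B).

Lemma conv_hull_bounded k (v : 'I_k -> 'cV[R]_n) x :
  conv_hull v x -> enorm x <= \sum_i enorm (v i).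
Proof.
move=> [w [w0 w1 ->]].
have ew i : w i <= 1.
  by rewrite -w1 (bigD1 i)//= lerDl sumr_ge0.
apply: (@le_trans _ _ (\sum_i enorm (w i *: v i))).
  elim/big_ind2 : _ => [|a b c d ab cd|//]; first by rewrite enorm0.
  by apply: le_trans (enormD _ _) _; exact: lerD.
apply: ler_sum => i _; rewrite enormZ ger0_norm//.
by rewrite ler_piMl ?enorm_ge0.
Qed.

Lemma within_bounded P Q : exists2 M, 0 <= M & within M P Q.
Proof.
have [k [v Pv]] := polytopeP P.
exists (\sum_i enorm (v i)); first by apply: sumr_ge0 => i _; exact: enorm_ge0.
move=> x Px; exists 0; first exact: polytope_origin.
by rewrite subr0; apply: conv_hull_bounded; rewrite -Pv.
Qed.

Lemma within_le r s A B : r <= s -> within r A B -> within s A B.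
Proof. by move=> rs W x /W[y By xy]; exists y => //; exact: le_trans rs. Qed.

Lemma hausdorff_radii_has_inf P Q : has_inf (hausdorff_radii P Q).
Proof.
split; last by exists 0 => r [].
have [M M0 PQ] := within_bounded P Q; have [N N0 QP] := within_bounded Q P.
exists (M + N); split; first exact: addr_ge0.
- by apply: within_le PQ; rewrite lerDl.
- by apply: within_le QP; rewrite lerDr.
Qed.

Lemma within_trans r s A B C :
  within r A B -> within s B C -> within (r + s) A C.
Proof.
move=> AB BC x /AB[y /BC[z Cz yz] xy]; exists z => //.
rewrite (_ : x - z = (x - y) + (y - z)); last by rewrite addrA subrK.
by apply: le_trans (enormD _ _) _; exact: lerD.
Qed.

Lemma hausdorff_distxx P : hausdorff_dist P P = 0.
Proof.
have i := hausdorff_radii_has_inf P P.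
apply/eqP; rewrite eq_le; apply/andP; split.
  apply: ge_inf; first exact: i.2.
  by split=> // x Px; exists x => //; rewrite subrr enorm0.
by apply: lb_le_inf; [exact: i.1|move=> r []].
Qed.

Lemma hausdorff_dist_sym P Q : hausdorff_dist P Q = hausdorff_dist Q P.
Proof.
by congr inf; apply/seteqP; split => r [].
Qed.

Lemma hausdorff_dist_triangle Q P S :
  hausdorff_dist P S <= hausdorff_dist P Q + hausdorff_dist Q S.
Proof.
apply/ler_addgt0Pl => e e0.
have e20 : 0 < e / 2 by rewrite divr_gt0.
have [r [r0 PQ QP] rd] := inf_adherent e20 (hausdorff_radii_has_inf P Q).
have [s [s0 QS SQ] sd] := inf_adherent e20 (hausdorff_radii_has_inf Q S).
apply: (@le_trans _ _ (r + s)); last first.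
  move: rd sd; rewrite -!/(hausdorff_dist _ _) => rd sd; lra.
apply: ge_inf; first exact: (hausdorff_radii_has_inf P S).2.
split; [exact: addr_ge0|exact: within_trans PQ QS|].
by rewrite addrC; exact: within_trans SQ QP.
Qed.

Lemma sum_continuous (U : topologicalType) (I : Type) (r : seq I)
    (F : I -> U -> R) :
  (forall i, continuous (F i)) -> continuous (fun u => \sum_(i <- r) F i u).
Proof.
move=> cF; elim: r => [|i r IHr] u.
  by under eq_fun do rewrite big_nil; exact: cvg_cst.
under eq_fun do rewrite big_cons.
by apply: cvgD; [exact: cF|exact: IHr].
Qed.

Lemma enorm_continuous (U : topologicalType) (f : U -> 'cV[R]_n) :
  (forall i, continuous (fun u => f u i ord0)) ->
  continuous (fun u => enorm (f u)).
Proof.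
move=> cf u.
apply: (@continuous_comp _ _ _ (fun u => \sum_i f u i ord0 ^+ 2) Num.sqrt).
  apply: sum_continuous => i {}u.
  under eq_fun do rewrite expr2.
  by apply: cvgM; exact: cf.
exact: sqrt_continuous.
Qed.

Lemma polytope_adherent P x :
  (forall e, 0 < e -> exists2 y, polytope_set P y & enorm (x - y) < e) ->
  polytope_set P x.
Proof.
have [k [v Pv]] := polytopeP P; rewrite Pv => clx.
pose D := [set w : 'rV[R]_k | (forall i, 0 <= w ord0 i <= 1)
  /\ \sum_i w ord0 i = 1].
pose f (w : 'rV[R]_k) := enorm (x - \sum_i w ord0 i *: v i).
have cD : compact D.
  pose I01 := [set` `[0, 1] : interval R].
  have c1 : compact [set w : 'rV[R]_k | forall i, I01 (w ord0 i)].
    apply: (@rV_compact _ _ (fun=> I01)) => _; exact: segment_compact.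
  have -> : D = [set w : 'rV[R]_k | forall i, I01 (w ord0 i)] `&`
      [set w : 'rV[R]_k | \sum_i w ord0 i = 1].
    by apply/seteqP; split => w [a b]; split => // i; have := a i;
      rewrite /I01/= in_itv.
  apply: compact_closedI => //.
  apply: (@closed_comp _ _ (fun w : 'rV[R]_k => \sum_i w ord0 i) [set 1]).
    by move=> w _; apply: sum_continuous => i; exact: coord_continuous.
  exact: closed_eq.
have D_of y : conv_hull v y -> exists2 w, D w & y = \sum_i w ord0 i *: v i.
  move=> [w [w0 w1 ->]]; exists (\row_i w i).
    split=> [i|]; last by rewrite -w1; apply: eq_bigr => i _; rewrite mxE.
    by rewrite mxE w0/= -w1 (bigD1 i)//= lerDl sumr_ge0.
  by apply: eq_bigr => i _; rewrite mxE.
have D0 : D !=set0.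
  have [y yP _] := clx 1 ltr01.
  by have [w Dw _] := D_of _ yP; exists w.
have cf : continuous f.
  apply: enorm_continuous => j.
  rewrite (_ : (fun _ => _) =
      (fun w : 'rV[R]_k => x j ord0 - \sum_i w ord0 i * v i j ord0)); last first.
    apply/funext => w; rewrite !mxE summxE; congr (_ - _).
    by apply: eq_bigr => i _; rewrite mxE.
  have cc : continuous (fun _ : 'rV[R]_k => x j ord0).
    by move=> w; exact: (@cst_continuous _ _ (x j ord0)).
  move=> w; apply: continuousB; first exact: cc.
  apply: (@sum_continuous _ _ _ (fun i (w : 'rV[R]_k) => w ord0 i * v i j ord0)).
  move=> i {}w; apply: (@continuousM _ _ (fun w : 'rV[R]_k => w ord0 i)).
    exact: coord_continuous.
  exact: (@cst_continuous _ _ (v i j ord0)).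
have [c /set_mem Dc minc] := EVT_min_rV D0 cD (continuous_subspaceT cf).
have : f c = 0.
  apply/eqP; rewrite eq_le enorm_ge0 andbT leNgt; apply/negP => /clx[y yP].
  have [w Dw ->] := D_of _ yP.
  by rewrite ltNge => /negP; apply; apply: minc; rewrite inE.
move=> /enorm0_eq0 /eqP; rewrite subr_eq0 => /eqP ->.
exists (fun i => c ord0 i); split => // [i|]; last exact: Dc.2.
by have /andP[] := Dc.1 i.
Qed.

Lemma hausdorff_dist_eq0 P Q : hausdorff_dist P Q = 0 -> P = Q.
Proof.
suff H P' Q' : hausdorff_dist P' Q' = 0 -> P' `<=` Q'.
  move=> d0; apply: polytope0_inj; apply/seteqP; split; apply: H => //.
  by rewrite hausdorff_dist_sym.
move=> d0 x Px; apply: polytope_adherent => e e0.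
have [r [r0 PQ QP]] := inf_adherent e0 (hausdorff_radii_has_inf P' Q').
rewrite -/(hausdorff_dist _ _) d0 add0r => re.
by have [y Qy xy] := PQ _ Px; exists y => //; exact: le_lt_trans re.
Qed.

HB.instance Definition _ := @isMetric.Build R (polytope0 R n)
  (fun P Q => hausdorff_dist P Q) hausdorff_distxx hausdorff_dist_eq0
  hausdorff_dist_sym hausdorff_dist_triangle.

End hausdorff.

Section volume.
Context {R : realType}.
Local Notation T := (measurableTypeR R).

Definition cons_pair n (p : T * n.-tuple T) : n.+1.-tuple T :=
  [the n.+1.-tuple T of p.1 :: p.2].

Lemma measurable_cons_pair n : measurable_fun setT (@cons_pair n).
Proof. by apply: (@measurable_cons _ _ (T * n.-tuple T)%type). Qed.

Section lebesgue_step.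
Context (n : nat) (m : {sigma_finite_measure set (n.-tuple T) -> \bar R}).

Definition lebesgue_step : set (n.+1.-tuple T) -> \bar R :=
  pushforward (@lebesgue_measure R \x m)%E (@cons_pair n).

Let step0 : lebesgue_step set0 = 0%E.
Proof. by rewrite /lebesgue_step /pushforward preimage_set0 measure0. Qed.

Let step_ge0 A : (0 <= lebesgue_step A)%E.
Proof. by rewrite /lebesgue_step /pushforward measure_ge0. Qed.

Let step_sigma_additive : semi_sigma_additive lebesgue_step.
Proof.
move=> F mF tF mUF; rewrite /lebesgue_step /pushforward preimage_bigcup.
have mc := @measurable_cons_pair n.
apply: measure_semi_sigma_additive.
- by move=> k; rewrite -[X in measurable X]setTI; exact: mc.
- apply/trivIsetP => /= i j _ _ ij; rewrite -preimage_setI.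
  by move/trivIsetP : tF => /(_ _ _ _ _ ij) ->//; rewrite preimage_set0.
- by rewrite -preimage_bigcup -[X in measurable X]setTI; exact: mc.
Qed.

HB.instance Definition _ := isMeasure.Build _ _ _ lebesgue_step
  step0 step_ge0 step_sigma_additive.

Let step_sigma_finite : sigma_finite setT lebesgue_step.
Proof.
have [F TF Foo] : sigma_finite setT (@lebesgue_measure R \x m)%E.
  have /sigma_finiteP[F [TF ndF Foo]] := sigma_finiteT (@lebesgue_measure R).
  have /sigma_finiteP[G [TG ndG Goo]] := sigma_finiteT m.
  exists (fun k => F k `*` G k).
    rewrite -setXTT TF TG predeqE => -[x y]; split; last first.
      by move=> [k _ []/= ? ?]; split; exists k.
    move=> [/= [k _ Fkx] [l _ Gly]]; exists (maxn k l) => //; split.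
    - by move: x Fkx; exact/subsetPset/ndF/leq_maxl.
    - by move: y Gly; exact/subsetPset/ndG/leq_maxr.
  move=> k; have [? ?] := Foo k; have [? ?] := Goo k.
  split; first exact: measurableX.
  by rewrite product_measure1E// lte_mul_pinfty// ge0_fin_numE.
pose g (t : n.+1.-tuple T) : T * n.-tuple T := (tnth t ord0, [tuple of behead t]).
have mg : measurable_fun setT g.
  apply/measurable_fun_pairP; split; first exact: measurable_tnth.
  exact: measurable_behead.
have gK t : cons_pair (g t) = t by rewrite /cons_pair/= [RHS]tuple_eta; apply: val_inj.
have Kg p : g (cons_pair p) = p.
  by case: p => a t; congr pair; apply: val_inj.
exists (fun k => g @^-1` F k).
  by rewrite -preimage_bigcup -TF preimage_setT.
move=> k; have [mF Fk] := Foo k; split.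
  by rewrite -[X in measurable X]setTI; exact: mg.
rewrite /lebesgue_step /pushforward (_ : _ @^-1` _ = F k)//.
by apply/seteqP; split => p /=; rewrite Kg.
Qed.

HB.instance Definition _ := Measure_isSigmaFinite.Build _ _ _ lebesgue_step
  step_sigma_finite.

End lebesgue_step.

(* Lebesgue measure on [R^n], as the [n]-fold product of the one-dimensional
   Lebesgue measure; for [n = 0] it is the unit mass on the one-point space. *)
Fixpoint lebesgue_tuple n : {sigma_finite_measure set (n.-tuple T) -> \bar R} :=
  if n is n'.+1 then lebesgue_step (lebesgue_tuple n')
  else dirac (nil_tuple T).

(* [fine] is harmless on polytopes: they are bounded. *)
Definition volume n (A : set 'cV[R]_n) : R :=
  fine (lebesgue_tuple n [set t | A (\col_i tnth t i)]).

End volume.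

Section functionals.
Context {R : realType} {n : nat}.
Implicit Types (Psi : polytope0 R n -> R) (P Q : polytope0 R n).

Definition euler_char (A : set 'cV[R]_n) : R := (`[< A !=set0 >])%:R.

Definition is_valuation Psi :=
  forall P Q PQU PQI : polytope0 R n,
    PQU = P `|` Q :> set _ -> PQI = P `&` Q :> set _ ->
    Psi P + Psi Q = Psi PQU + Psi PQI.

Lemma is_polytope_mulmx (A : 'M[R]_n) (P : set 'cV[R]_n) :
  is_polytope P -> is_polytope (mulmx A @` P).
Proof.
move=> [k [v ->]]; exists k, (fun i => A *m v i); apply/seteqP; split.
  move=> _ [x [w [w0 w1 ->]] <-]; exists w; split => //.
  by rewrite mulmx_sumr; apply: eq_bigr => i _; rewrite scalemxAr.
move=> x [w [w0 w1 ->]]; exists (\sum_i w i *: v i); first by exists w.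
by rewrite mulmx_sumr; apply: eq_bigr => i _; rewrite scalemxAr.
Qed.

Lemma mulmx_origin (A : 'M[R]_n) P : (mulmx A @` P) 0.
Proof. by exists 0; [exact: polytope_origin|exact: mulmx0]. Qed.

Definition polytope_mulmx (A : 'M[R]_n) P : polytope0 R n :=
  Polytope0 (is_polytope_mulmx A (polytopeP P)) (mulmx_origin A P).

Definition SL_invariant Psi :=
  forall (A : 'M[R]_n) P, \det A = 1 -> Psi (polytope_mulmx A P) = Psi P.

(* Real-valued mirror image of the library's [lower_semicontinuous]. *)
Definition upper_semicontinuous (X : topologicalType) (f : X -> R) :=
  forall x a, f x < a -> \forall y \near x, f y < a.

End functionals.

(* Main.v *)
(* Psi is compared with c0 + cn V on simplices with a vertex at the origin, and
   a valuation that vanishes on all of those vanishes identically.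

   The second point needs no facet structure.  Write P by linear inequalities.
   Cuts along differences f_i - f_j of the forms of the inequalities f_i <= 1
   reduce P to {f <= 1} inside a polyhedral cone.  For a point u of that cone
   with f(u) = 1, cuts along differences of the forms that are positive at u
   (normalised to 1 there) reduce to the case of one such form g, and u then
   becomes a vertex with dual functional g.  All these differences vanish at the
   vertices already found, so the process can be repeated on {f = 1, g = 0}, and
   it stops at simplices.

   On simplices of dimension j, 0 < j < n, Psi takes a single value tau, because
   SL(n) acts transitively on them and an edge can be bisected.  On simplices of
   full dimension Psi - tau depends additively on the determinant, and upper
   semicontinuity makes this dependence linear.  Finally tau = Psi {0}: shrinking
   a segment to the origin gives tau <= Psi {0}, and flattening the diamond with
   vertices e0, -e0, t e1, -t e1 to a segment gives the converse.  The same holds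
   for the volume, which is an SL(n) invariant continuous valuation. *)
Require Import Defs.
From mathcomp Require Import all_boot all_order all_algebra.
From mathcomp Require Import all_classical all_reals all_analysis.
From mathcomp Require Import perm measurable_realfun ring lra.

Set Implicit Arguments.
Unset Strict Implicit.
Unset Printing Implicit Defensive.

Import Order.TTheory GRing.Theory Num.Theory.
Import numFieldNormedType.Exports.

Local Open Scope classical_set_scope.
Local Open Scope ring_scope.

(** * Polytopes as hulls with the origin, and their cuts by linear hyperplanes *)

Section dot_product.
Context {R : realType} {n : nat}.
Implicit Types a x y : 'cV[R]_n.

Definition dot a x : R := \sum_i a i ord0 * x i ord0.

Lemma dotC a x : dot a x = dot x a.
Proof. by apply: eq_bigr => i _; rewrite mulrC. Qed.

Lemma dotDr a x y : dot a (x + y) = dot a x + dot a y.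
Proof. by rewrite -big_split/=; apply: eq_bigr => i _; rewrite mxE mulrDr. Qed.

Lemma dotZr a c x : dot a (c *: x) = c * dot a x.
Proof. by rewrite mulr_sumr; apply: eq_bigr => i _; rewrite mxE; ring. Qed.

Lemma dotNr a x : dot a (- x) = - dot a x.
Proof. by rewrite -scaleN1r dotZr mulN1r. Qed.

Lemma dotBr a x y : dot a (x - y) = dot a x - dot a y.
Proof. by rewrite dotDr dotNr. Qed.

Lemma dot0r a : dot a 0 = 0.
Proof. by rewrite -(scale0r 0) dotZr mul0r. Qed.

Lemma dot_sumr a (I : Type) (r : seq I) (P : pred I) (v : I -> 'cV[R]_n) :
  dot a (\sum_(i <- r | P i) v i) = \sum_(i <- r | P i) dot a (v i).
Proof.
by elim/big_rec2 : _ => [|i y x _ <-]; [exact: dot0r|rewrite dotDr].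
Qed.

Lemma dotDl a b x : dot (a + b) x = dot a x + dot b x.
Proof. by rewrite dotC dotDr !(dotC x). Qed.

Lemma dotZl a c x : dot (c *: a) x = c * dot a x.
Proof. by rewrite dotC dotZr dotC. Qed.

Lemma dotNl a x : dot (- a) x = - dot a x.
Proof. by rewrite dotC dotNr dotC. Qed.

Lemma dotBl a b x : dot (a - b) x = dot a x - dot b x.
Proof. by rewrite dotDl dotNl. Qed.

Lemma dot0l x : dot 0 x = 0.
Proof. by rewrite dotC dot0r. Qed.

Lemma dot_delta i x : dot (delta_mx i ord0) x = x i ord0.
Proof.
rewrite /dot (bigD1 i)//= big1 ?addr0 => [|j ji].
  by rewrite mxE !eqxx mul1r.
by rewrite mxE (negbTE ji) mul0r.
Qed.

Lemma dot_le_enorm a x : dot a x <= enorm a * enorm x.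
Proof. exact: cauchy_schwarz. Qed.

Lemma dot_norm_le a x : `|dot a x| <= enorm a * enorm x.
Proof.
by rewrite ler_norml dot_le_enorm andbT lerNl -dotNl -(enormN a) dot_le_enorm.
Qed.

End dot_product.

(** * Hulls of a finite family with the origin, and their halfspace cuts *)

Section hulls.
Context {R : realType} {n : nat}.
Local Notation V := 'cV[R]_n.

(** Weights of total at most 1 leave the missing mass at the origin: this is the convex hull of the
    family and 0, and zero generators can be added or dropped freely. *)
Definition hull0 (I : finType) (v : I -> V) : set V :=
  [set x | exists w : I -> R,
    [/\ forall i, 0 <= w i, \sum_i w i <= 1 & x = \sum_i w i *: v i]].

Lemma hull00 (I : finType) (v : I -> V) : hull0 v 0.
Proof.
exists (fun=> 0); split=> //; first by rewrite big1.
by rewrite big1// => i _; rewrite scale0r.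
Qed.

Lemma hull0_gen (I : finType) (v : I -> V) i : hull0 v (v i).
Proof.
exists (fun j => (i == j)%:R); split=> [j||]; first exact: ler0n.
  rewrite (bigD1 i)//= eqxx big1 ?addr0// => j ji.
  by rewrite eq_sym (negbTE ji).
rewrite (bigD1 i)//= eqxx scale1r big1 ?addr0// => j ji.
by rewrite eq_sym (negbTE ji) scale0r.
Qed.

Lemma hull0_convex (I J : finType) (v : I -> V) (w : J -> R) (y : J -> V) :
  (forall j, 0 <= w j) -> \sum_j w j <= 1 -> (forall j, hull0 v (y j)) ->
  hull0 v (\sum_j w j *: y j).
Proof.
move=> w0 w1 /choice[c /all_and3 [c0 c1 yc]].
exists (fun i => \sum_j w j * c j i); split.
- by move=> i; apply: sumr_ge0 => j _; exact: mulr_ge0.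
- rewrite exchange_big/=; apply: le_trans w1; apply: ler_sum => j _.
  by rewrite -mulr_sumr ler_piMr.
- under [RHS]eq_bigr do rewrite scaler_suml.
  rewrite exchange_big/=; apply: eq_bigr => j _.
  by rewrite yc scaler_sumr; apply: eq_bigr => i _; rewrite scalerA.
Qed.

Lemma hull0_sub (I J : finType) (v : I -> V) (u : J -> V) :
  (forall i, hull0 u (v i)) -> hull0 v `<=` hull0 u.
Proof. by move=> vu x [w [w0 w1 ->]]; exact: hull0_convex. Qed.

Lemma hull0_eq (I J : finType) (v : I -> V) (u : J -> V) :
  (forall i, hull0 u (v i)) -> (forall j, hull0 v (u j)) -> hull0 v = hull0 u.
Proof. by move=> vu uv; apply/seteqP; split; exact: hull0_sub. Qed.

Lemma hull0_eq0 (I J : finType) (v : I -> V) (u : J -> V) :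
  (forall i, v i = 0 \/ exists j, v i = u j) ->
  (forall j, u j = 0 \/ exists i, u j = v i) -> hull0 v = hull0 u.
Proof.
move=> vu uv; apply: hull0_eq => i.
  by have [->|[j ->]] := vu i; [exact: hull00|exact: hull0_gen].
by have [->|[j ->]] := uv i; [exact: hull00|exact: hull0_gen].
Qed.

Lemma hull0_conv2 (I : finType) (v : I -> V) a b x y :
  0 <= a -> 0 <= b -> a + b <= 1 -> hull0 v x -> hull0 v y ->
  hull0 v (a *: x + b *: y).
Proof.
move=> a0 b0 ab vx vy.
rewrite (_ : _ + _ = \sum_(j : bool) (if j then a else b) *: (if j then x else y)).
  apply: hull0_convex => [[]|| []]//.
  by rewrite big_bool.
by rewrite big_bool.
Qed.

Lemma hull0_polytope (I : finType) (v : I -> V) : is_polytope (hull0 v).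
Proof.
exists #|{: option I}|, (fun k => if enum_val k is Some i then v i else 0).
apply/seteqP; split=> [x [w [w0 w1 ->]]|x [w [w0 w1 ->]]].
  pose w' (o : option I) := if o is Some i then w i else 1 - \sum_i w i.
  have osum (T : nmodType) (F : option I -> T) :
      \sum_(k < #|{: option I}|) F (enum_val k) = F None + \sum_i F (Some i).
    rewrite -(big_enum_val F) (bigD1 None)//=; congr (_ + _).
    rewrite (reindex_omap (@Some I) id)//=; last by case.
    by apply: eq_bigl => i; rewrite !eqxx.
  exists (fun k => w' (enum_val k)); split.
  - by move=> k; rewrite /w'; case: (enum_val k) => [i|]//; rewrite subr_ge0.
  - by rewrite (osum _ w') /= subrK.
  - rewrite (osum _ (fun o => w' o *: (if o is Some i then v i else 0)))/=.
    by rewrite scaler0 add0r.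
apply: hull0_convex => //; first by rewrite w1.
by move=> k; case: (enum_val k) => [i|]; [exact: hull0_gen|exact: hull00].
Qed.

Definition poly_hull0 (I : finType) (v : I -> V) : polytope0 R n :=
  Polytope0 (hull0_polytope v) (hull00 v).

Lemma polytope0_hull0 (P : polytope0 R n) :
  exists k (v : 'I_k -> V), P = poly_hull0 v.
Proof.
have [k [v Pv]] := polytopeP P; exists k, v; apply: polytope0_inj => /=.
rewrite Pv; apply/seteqP; split=> [x [w [w0 w1 ->]]|x [w [w0 w1 ->]]].
  by exists w; split=> //; rewrite w1.
(* Convex weights [z] representing 0 absorb the missing mass [1 - \sum_i w i] without moving the
   point. *)
have [z [z0 z1 ez]] : conv_hull v 0 by rewrite -Pv; exact: polytope_origin.
exists (fun i => w i + (1 - \sum_i w i) * z i); split.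
- by move=> i; rewrite addr_ge0// mulr_ge0// subr_ge0.
- by rewrite big_split/= -mulr_sumr z1 mulr1 addrC subrK.
- under [RHS]eq_bigr do rewrite scalerDl -scalerA.
  by rewrite big_split/= -scaler_sumr -ez scaler0 addr0.
Qed.

Lemma polytope0_bounded (P : polytope0 R n) :
  exists2 M, 0 <= M & forall x, polytope_set P x -> enorm x <= M.
Proof.
have [k [v Pv]] := polytopeP P; exists (\sum_i enorm (v i)).
  by apply: sumr_ge0 => i _; exact: enorm_ge0.
by move=> x Px; apply: conv_hull_bounded; rewrite -Pv.
Qed.

(** A bounded set contains no ray: a large multiple of a nonzero [y] exceeds the bound. *)
Lemma polytope0_recession (P : polytope0 R n) (y : V) :
  (forall c, 0 <= c -> polytope_set P (c *: y)) -> y = 0.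
Proof.
move=> Py; apply: enorm0_eq0; have [M M0 PM] := polytope0_bounded P.
apply/eqP; rewrite -[_ == _]negbK; apply/negP => y0.
have ygt0 : 0 < enorm y by rewrite lt_neqAle eq_sym y0 enorm_ge0.
have c0 : 0 <= (M + 1) / enorm y by rewrite divr_ge0 ?enorm_ge0// addr_ge0.
have := PM _ (Py _ c0); rewrite enormZ ger0_norm// divfK//.
by rewrite leNgt ltrDl ltr01.
Qed.

Section cut.
Variables (I : finType) (v : I -> V) (h : V).

(* The point where the segment [v i, v j] crosses the hyperplane [h = 0]. *)
Definition crossing i j : V :=
  (dot h (v i) - dot h (v j))^-1 *: (dot h (v i) *: v j - dot h (v j) *: v i).

(** The value 0 is a placeholder for indices that contribute nothing; [hull0] contains it anyway. *)
Definition cut_gen (k : I + I * I) : V :=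
  match k with
  | inl i => if 0 <= dot h (v i) then v i else 0
  | inr (i, j) =>
      if (0 < dot h (v i)) && (dot h (v j) < 0) then crossing i j else 0
  end.

Lemma dot_crossing i j : dot h (crossing i j) = 0.
Proof. by rewrite dotZr dotBr !dotZr; ring. Qed.

Lemma crossing_hull0 i j :
  0 < dot h (v i) -> dot h (v j) < 0 -> hull0 v (crossing i j).
Proof.
move=> hi hj; rewrite /crossing scalerBr !scalerA -scaleNr.
have d0 : 0 < dot h (v i) - dot h (v j) by lra.
apply: hull0_conv2; try exact: hull0_gen.
- by rewrite mulr_ge0 ?invr_ge0 ?ltW.
- by rewrite -mulrN mulr_ge0 ?invr_ge0 ?oppr_ge0 ?ltW.
- by rewrite -mulrN -mulrDr mulVf// gt_eqF.
Qed.

(** In the cut the positive generators outweigh the negative ones, so all negative weight can be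
    paired with positive weight and moved to crossing points. *)
Lemma hull0_cut : hull0 v `&` [set x | 0 <= dot h x] = hull0 cut_gen.
Proof.
pose H i := dot h (v i).
have HE i : H i = dot h (v i) by [].
clearbody H.
apply/seteqP; split=> x; last first.
  move=> xc; split.
    apply: hull0_sub xc; case=> [i|[i j]] /=.
      by case: ifP => _; [exact: hull0_gen|exact: hull00].
    by case: ifP => [/andP[? ?]|_]; [exact: crossing_hull0|exact: hull00].
  case: xc => w [w0 _ ->] /=; rewrite dot_sumr; apply: sumr_ge0 => k _.
  rewrite dotZr mulr_ge0//; case: k => [i|[i j]]/=.
    by case: ifP => //; rewrite dot0r.
  by case: ifP => _; rewrite ?dot_crossing ?dot0r.
move=> [[w [w0 w1 xE]] /= hx].
(* [S] and [N] are the positive and negative parts of the height of [x]. *)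
pose S := \sum_(i | 0 < H i) w i * H i.
pose N := \sum_(i | H i < 0) w i * - H i.
have SN : dot h x = S - N.
  rewrite xE dot_sumr /S /N -sumrN.
  rewrite [X in X + _]big_mkcond [X in _ + X]big_mkcond -big_split/=.
  apply: eq_bigr => i _; rewrite dotZr -HE.
  by case: (ltgtP (H i) 0) => [h0|h0|->]; lra.
have N0 : 0 <= N.
  by apply: sumr_ge0 => i /ltW h0; rewrite mulr_ge0// oppr_ge0.
have NS : N <= S by move: hx; rewrite SN subr_ge0.
(* Here [N = 0] too, so no weight sits on a negative generator and [w] itself serves. *)
have [S0|S0] := eqVneq S 0.
  have : N == 0 by rewrite eq_le N0 -S0 NS.
  rewrite psumr_eq0 => [/allP wN|i /ltW h0]; last by rewrite mulr_ge0// oppr_ge0.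
  exists (fun k => if k is inl i then w i else 0); split.
  - by case.
  - by rewrite big_sumType/= [X in _ + X]big1 ?addr0.
  - rewrite big_sumType/= [X in _ + X]big1 ?addr0; last first.
      by move=> k _; rewrite scale0r.
    rewrite xE; apply: eq_bigr => i _; rewrite -HE; case: (leP 0 (H i)) => // hi.
    have := wN i (mem_index_enum _); rewrite hi/= mulf_eq0 oppr_eq0.
    by rewrite (lt_eqF hi) orbF => /eqP ->; rewrite !scale0r.
have Sgt0 : 0 < S by rewrite lt_neqAle eq_sym S0 (le_trans N0).
have NS1 : N / S <= 1 by rewrite ler_pdivrMr ?mul1r.
(* A fraction [N / S] of each positive weight and all of each negative weight go to the crossings.
   As [(H i - H j) *: crossing i j = H i *: v j - H j *: v i], the weights [b i j] restore exactly
   what was removed. *)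
pose a i := if 0 < H i then w i * (1 - N / S) else if H i < 0 then 0 else w i.
pose b i j := if (0 < H i) && (H j < 0) then w i * w j * (H i - H j) / S else 0.
have sum_pair (W : nmodType) (F : I -> I -> W) :
    \sum_(k : I * I) (if (0 < H k.1) && (H k.2 < 0) then F k.1 k.2 else 0) =
    \sum_(i | 0 < H i) \sum_(j | H j < 0) F i j.
  by rewrite -big_mkcond pair_big_dep.
have split3 (W : nmodType) (F : I -> W) : \sum_i F i =
    \sum_(i | 0 < H i) F i + (\sum_(i | H i < 0) F i + \sum_(i | H i == 0) F i).
  rewrite (bigID (fun i => 0 < H i))/=; congr (_ + _).
  rewrite (bigID (fun i => H i < 0))/=; congr (_ + _).
    by apply: eq_bigl => i; case: (ltgtP (H i) 0).
  by apply: eq_bigl => i; case: (ltgtP (H i) 0).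
have suma (W : lmodType R) (F : I -> W) : \sum_i a i *: F i =
    (1 - N / S) *: \sum_(i | 0 < H i) w i *: F i + \sum_(i | H i == 0) w i *: F i.
  rewrite split3 scaler_sumr; congr (_ + _).
    by apply: eq_bigr => i hi; rewrite /a hi scalerA mulrC.
  rewrite big1 ?add0r => [|i hi]; last by rewrite /a ltNge (ltW hi)/= hi scale0r.
  by apply: eq_bigr => i /eqP hi; rewrite /a hi ltxx.
exists (fun k => match k with inl i => a i | inr (i, j) => b i j end); split.
- case=> [i|[i j]]; rewrite /a /b.
    by case: ifP => _; [rewrite mulr_ge0// subr_ge0|case: ifP].
  case: ifP => // /andP[hi hj]; rewrite divr_ge0 ?(ltW Sgt0)// mulr_ge0//.
    exact: mulr_ge0.
  by rewrite subr_ge0 ltW// (lt_trans hj).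
- apply: le_trans w1; rewrite big_sumType/=.
  (* With all [F i = 1] in the module [R^o], [suma] evaluates the total of the weights [a i]. *)
  have := suma R^o (fun=> 1); rewrite /GRing.scale/=.
  under eq_bigr do rewrite mulr1.
  under [in X in _ = X -> _]eq_bigr do rewrite mulr1.
  under [in X in _ = _ + X -> _]eq_bigr do rewrite mulr1.
  move=> ->.
  rewrite [X in _ + X <= _](eq_bigr (fun k => if (0 < H k.1) && (H k.2 < 0)
      then w k.1 * w k.2 * (H k.1 - H k.2) / S else 0)); last by case.
  rewrite (sum_pair _ (fun i j => w i * w j * (H i - H j) / S)).
  rewrite [X in _ + X <= _](eq_bigr (fun i => w i * H i * S^-1 * (\sum_(j | H j < 0) w j)
     + w i * (S^-1 * N))) => [|i _]; last first.
    rewrite /N !mulr_sumr -big_split/=; apply: eq_bigr => j _.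
    have rE (p q r s t : R) : p * q * (r - s) * t = p * r * t * q + p * (t * (q * - s)).
      by ring.
    exact: rE.
  rewrite big_split/= -!mulr_suml -/S mulfV// mul1r split3/=.
  have rE (p q r s t : R) : (1 - p * q) * r + s + (t + r * (q * p)) = r + (t + s).
    by ring.
  by rewrite le_eqVlt; apply/orP; left; apply/eqP; exact: rE.
- rewrite big_sumType/= (eq_bigr (fun i => a i *: v i)); last first.
    move=> i _; rewrite /a -HE; case: (ltgtP 0 (H i)) => //= hi.
    by rewrite !scale0r.
  rewrite suma.
  rewrite [X in _ = _ + X](eq_bigr (fun k => if (0 < H k.1) && (H k.2 < 0)
      then (w k.1 * w k.2 / S) *: (H k.1 *: v k.2 - H k.2 *: v k.1) else 0));
      last first.
    case=> i j _ /=; rewrite /b -!HE; case: ifP => [/andP[hi hj]|].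
      rewrite /crossing -!HE scalerA; congr (_ *: _).
      have d0 : H i - H j != 0 by rewrite gt_eqF// subr_gt0 (lt_trans hj).
      by rewrite mulrAC mulfK.
    by rewrite scale0r.
  rewrite (sum_pair _ (fun i j => (w i * w j / S) *: (H i *: v j - H j *: v i))).
  rewrite [X in _ = _ + X](eq_bigr (fun i => (w i * H i * S^-1) *: (\sum_(j | H j < 0) w j *: v j)
     + (N / S) *: (w i *: v i))) => [|i _]; last first.
    rewrite /N !mulr_suml scaler_suml scaler_sumr -big_split/=.
    apply: eq_bigr => j _; rewrite scalerBr !scalerA -scaleNr.
    have rE (p q r s : R) : p * q * r * s = p * s * r * q by ring.
    have rE' (p q r s : R) : - (p * q * r * s) = q * - s * r * p by ring.
    by rewrite rE rE'.
  rewrite big_split/= -scaler_suml -scaler_sumr -mulr_suml -/S mulfV// scale1r.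
  rewrite xE split3 scalerBl scale1r.
  set X := \sum_(i | 0 < _) _; set Y := \sum_(i | _ < 0) _; set Z := \sum_(i | _ == _) _.
  by rewrite [Y + _ *: _]addrC addrACA subrK [Z + Y]addrC.
Qed.

End cut.

End hulls.

(** * Cutting polytopes and valuations along a linear hyperplane *)

Section polytope_cuts.
Context {R : realType} {n : nat}.
Local Notation V := 'cV[R]_n.

Lemma is_polytope_cut (h : V) (P : polytope0 R n) :
  is_polytope (polytope_set P `&` [set x | 0 <= dot h x]).
Proof.
have [k [v ->]] := polytope0_hull0 P.
by rewrite /= hull0_cut; exact: hull0_polytope.
Qed.

Lemma polytope_cut_origin (h : V) (P : polytope0 R n) :
  (polytope_set P `&` [set x | 0 <= dot h x]) 0.
Proof. by split; [exact: polytope_origin|rewrite /= dot0r]. Qed.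

Definition polytope_cut (h : V) (P : polytope0 R n) : polytope0 R n :=
  Polytope0 (is_polytope_cut h P) (polytope_cut_origin h P).

(** The halves cover [P] and meet in the section. Pieces are described pointwise so that any
    representation of them can be supplied. *)
Lemma valuation_cut (Psi : polytope0 R n -> R) h (P P1 P2 P0 : polytope0 R n) :
  is_valuation Psi ->
  (forall x, polytope_set P1 x <-> polytope_set P x /\ 0 <= dot h x) ->
  (forall x, polytope_set P2 x <-> polytope_set P x /\ dot h x <= 0) ->
  (forall x, polytope_set P0 x <-> polytope_set P x /\ dot h x = 0) ->
  Psi P1 + Psi P2 = Psi P + Psi P0.
Proof.
move=> val P1E P2E P0E; apply: val; apply/seteqP; split=> x /=.
- by move=> Px; case: (leP 0 (dot h x)) => [?|/ltW ?]; [left|right];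
    [apply/P1E|apply/P2E].
- by case=> [/P1E[]|/P2E[]].
- by move=> /P0E[? h0]; split; [apply/P1E|apply/P2E]; rewrite h0.
- move=> [/P1E[Px h1] /P2E[_ h2]]; apply/P0E; split=> //.
  by apply/eqP; rewrite eq_le h1 h2.
Qed.

(* [m] is the point where the hyperplane [h = 0] meets the edge [v p, v q]. *)
Lemma hull0_cut_edge (I : finType) (v : I -> V) (h : V) (p q : I) (a b : R) :
  0 < a -> 0 < b -> dot h (v p) = a -> dot h (v q) = - b ->
  (forall i, i != p -> i != q -> dot h (v i) = 0) ->
  let m := (b / (a + b)) *: v p + (a / (a + b)) *: v q in
  [/\ hull0 v `&` [set x | 0 <= dot h x] =
        hull0 (fun i => if i == q then m else v i),
      hull0 v `&` [set x | dot h x <= 0] =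
        hull0 (fun i => if i == p then m else v i) &
      hull0 v `&` [set x | dot h x = 0] =
        hull0 (fun i => if i == p then 0 else if i == q then m else v i)].
Proof.
move=> a0 b0 hp hq h0 m.
have ab0 : 0 < a + b by rewrite addr_gt0.
have abn0 : a + b != 0 by rewrite gt_eqF.
have pq : p != q by apply/eqP => pq; move: hp; rewrite pq hq; lra.
have hm : dot h m = 0 by rewrite dotDr !dotZr hp hq; field.
have mv : hull0 v m.
  apply: hull0_conv2; try exact: hull0_gen.
  - by rewrite divr_ge0 ?ltW.
  - by rewrite divr_ge0 ?ltW.
  - by rewrite -mulrDl [b + a]addrC mulfV.
have sum2 (W : nmodType) (F : I -> W) :
    \sum_i F i = F p + (F q + \sum_(i | (i != p) && (i != q)) F i).
  by rewrite (bigD1 p)//= (bigD1 q)//= eq_sym.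
have dotE (w : I -> R) : dot h (\sum_i w i *: v i) = w p * a - w q * b.
  rewrite dot_sumr sum2 !dotZr hp hq big1 ?addr0 ?mulrN// => i /andP[ip iq].
  by rewrite dotZr h0// mulr0.
split; apply/seteqP; split => x.
- move=> [[w [w0 w1 ->]]] /=; rewrite dotE => wab.
  (* Solving the definition of [m] for [v q] gives [v q = ((a + b) m - b (v p)) / a]; the
     coefficient left at [v p] is nonnegative by [wab]. *)
  exists (fun i => if i == q then w q * (a + b) / a
      else if i == p then w p - w q * b / a else w i); split.
  + move=> i; case: eqP => _; first by rewrite divr_ge0 ?mulr_ge0// ltW.
    case: eqP => _ //; rewrite subr_ge0 ler_pdivrMr//; lra.
  + apply: le_trans w1; rewrite !sum2 !eqxx (negbTE pq).
    rewrite (eq_bigr w); last by move=> i /andP[/negbTE -> /negbTE ->].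
    rewrite !addrA lerD2r le_eqVlt; apply/orP; left; apply/eqP; field.
    by rewrite gt_eqF.
  + rewrite !sum2 !eqxx (negbTE pq).
    rewrite [in RHS](eq_bigr (fun i => w i *: v i)); last first.
      by move=> i /andP[/negbTE -> /negbTE ->].
    rewrite !addrA; congr (_ + _).
    rewrite /m scalerDr !scalerA addrA -scalerDl.
    by congr (_ *: _ + _ *: _); field; rewrite ?abn0 gt_eqF.
- move=> xv; split.
    apply: hull0_sub xv => i; case: ifP => // _; exact: hull0_gen.
  case: xv => w [w0 _ ->] /=; rewrite dot_sumr; apply: sumr_ge0 => i _.
  rewrite dotZr mulr_ge0//; case: eqP => [_|/eqP iq]; first by rewrite hm.
  have [->|ip] := eqVneq i p; first by rewrite hp ltW.
  by rewrite h0.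
- move=> [[w [w0 w1 ->]]] /=; rewrite dotE => wab.
  exists (fun i => if i == p then w p * (a + b) / b
      else if i == q then w q - w p * a / b else w i); split.
  + move=> i; case: eqP => _; first by rewrite divr_ge0 ?mulr_ge0// ltW.
    case: eqP => _ //; rewrite subr_ge0 ler_pdivrMr//; lra.
  + apply: le_trans w1; rewrite !sum2 !eqxx eq_sym (negbTE pq).
    rewrite (eq_bigr w); last by move=> i /andP[/negbTE -> /negbTE ->].
    rewrite !addrA lerD2r le_eqVlt; apply/orP; left; apply/eqP; field.
    by rewrite gt_eqF.
  + rewrite !sum2 !eqxx eq_sym (negbTE pq).
    rewrite [in RHS](eq_bigr (fun i => w i *: v i)); last first.
      by move=> i /andP[/negbTE -> /negbTE ->].
    rewrite !addrA; congr (_ + _).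
    rewrite /m scalerDr !scalerA -addrA -scalerDl.
    by congr (_ *: _ + _ *: _); field; rewrite ?abn0 gt_eqF.
- move=> xv; split.
    apply: hull0_sub xv => i; case: ifP => // _; exact: hull0_gen.
  case: xv => w [w0 _ ->] /=; rewrite dot_sumr; apply: sumr_le0 => i _.
  rewrite dotZr mulr_ge0_le0//; case: eqP => [_|/eqP ip]; first by rewrite hm.
  have [->|iq] := eqVneq i q; first by rewrite hq oppr_le0 ltW.
  by rewrite h0.
- move=> [[w [w0 w1 ->]]] /=; rewrite dotE => /eqP; rewrite subr_eq0 => /eqP wab.
  (* On the hyperplane [w p * a = w q * b], so the weights at [v p] and [v q] merge into one weight
     at [m]. *)
  exists (fun i => if i == p then 0
      else if i == q then w p + w q else w i); split.
  + by move=> i; case: eqP => // _; case: eqP => // _; rewrite addr_ge0.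
  + apply: le_trans w1; rewrite !sum2 !eqxx eq_sym (negbTE pq).
    rewrite (eq_bigr w); last by move=> i /andP[/negbTE -> /negbTE ->].
    by rewrite add0r addrA.
  + rewrite !sum2 !eqxx eq_sym (negbTE pq).
    rewrite [in RHS](eq_bigr (fun i => w i *: v i)); last first.
      by move=> i /andP[/negbTE -> /negbTE ->].
    rewrite scale0r add0r !addrA; congr (_ + _).
    have -> : w q = w p * a / b by rewrite wab mulfK ?gt_eqF.
    rewrite /m scalerDr !scalerA.
    by congr (_ *: _ + _ *: _); field; rewrite ?abn0 gt_eqF.
- move=> xv; split.
    apply: hull0_sub xv => i; case: ifP => _; first exact: hull00.
    by case: ifP => // _; exact: hull0_gen.
  case: xv => w [w0 _ ->] /=; rewrite dot_sumr; apply: big1 => i _.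
  rewrite dotZr; case: eqP => [_|/eqP ip]; first by rewrite dot0r mulr0.
  case: eqP => [_|/eqP iq]; first by rewrite hm mulr0.
  by rewrite h0// mulr0.
Qed.

End polytope_cuts.

(** * Description of a polytope by finitely many linear inequalities *)

Section halfspace_representation.
Context {R : realType} {n : nat}.
Local Notation V := 'cV[R]_n.
(* The pair [(a, b)] stands for the linear form [(x, s) |-> a.x + b s]. *)
Implicit Types (l : V * R) (p : V * R) (L : seq (V * R)).

Definition pdot l p : R := dot l.1 p.1 + l.2 * p.2.

Definition in_cone L p := forall l, l \in L -> 0 <= pdot l p.

Lemma pdotDr l p q : pdot l (p + q) = pdot l p + pdot l q.
Proof. by rewrite /pdot dotDr mulrDr addrACA. Qed.

Lemma pdotZr l c p : pdot l (c *: p) = c * pdot l p.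
Proof. by rewrite /pdot dotZr mulrDr mulrCA. Qed.

Lemma pdotBr l p q : pdot l (p - q) = pdot l p - pdot l q.
Proof. by rewrite pdotDr -scaleN1r pdotZr mulN1r. Qed.

Lemma pdot_comb c l d m p :
  pdot (c *: l - d *: m) p = c * pdot l p - d * pdot m p.
Proof. by rewrite /pdot/= dotBl !dotZl /GRing.scale/=; ring. Qed.

(* One step of Fourier-Motzkin elimination. *)
Definition add_ray L r : seq (V * R) :=
  [seq l <- L | 0 <= pdot l r] ++
  [seq pdot l r *: m - pdot m r *: l |
    l <- [seq l <- L | 0 < pdot l r], m <- [seq m <- L | pdot m r < 0]].

(** Forms negative on [r] bound [t] from below, positive ones from above. The combined forms in
    [add_ray] say that every lower bound is at most every upper bound, so the larger of 0 and the
    greatest lower bound is a valid [t]. *)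
Lemma in_add_ray L r p :
  in_cone (add_ray L r) p <-> exists2 t, 0 <= t & in_cone L (p - t *: r).
Proof.
split=> [Lp|[t t0 Lpt] l].
  pose t := \big[Num.max/0]_(m <- L | pdot m r < 0) (pdot m p / pdot m r).
  have t0 : 0 <= t by exact: bigmax_ge_id.
  exists t => // l lL; rewrite pdotBr pdotZr subr_ge0.
  have [lr|lr|lr] := ltgtP (pdot l r) 0.
  - rewrite -ler_ndivrMr// /t.
    apply: (@bigmax_sup_seq _ _ _ _ 0 l (fun m => pdot m r < 0) _
      (fun m => pdot m p / pdot m r)) => //.
  - rewrite -ler_pdivlMr// /t big_seq_cond.
    apply: bigmax_le => [|m /andP[mL mr]].
      apply: divr_ge0 (ltW lr); apply: Lp.
      by rewrite mem_cat mem_filter (ltW lr) lL.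
    rewrite ler_pdivlMr// -[_ / _ * _]mulrAC ler_ndivrMr//.
    rewrite [X in X <= _]mulrC [X in _ <= X]mulrC.
    rewrite -subr_ge0 -pdot_comb; apply: Lp; rewrite mem_cat; apply/orP; right.
    by apply/allpairsP; exists (l, m); rewrite !mem_filter mr mL lr lL.
  - by rewrite lr mulr0; apply: Lp; rewrite mem_cat mem_filter lr lexx lL.
rewrite mem_cat => /orP[|].
  rewrite mem_filter => /andP[lr /Lpt]; rewrite pdotBr pdotZr subr_ge0.
  by apply: le_trans; rewrite mulr_ge0.
move=> /allpairsP[[a b] /= []]; rewrite !mem_filter => /andP[ar aL] /andP[br bL] ->.
rewrite pdot_comb.
have := Lpt _ aL; have := Lpt _ bL; rewrite !pdotBr !pdotZr => hb ha.
by nra.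
Qed.

(** Pairs of opposite coordinate forms leave only the ray spanned by [(0, 1)], which stands for the
    origin as a generator. *)
Definition base_cone : seq (V * R) :=
  (0, 1) :: [seq (delta_mx i ord0, 0) | i <- enum 'I_n] ++
            [seq (- delta_mx i ord0, 0) | i <- enum 'I_n].

Lemma in_base_cone p : in_cone base_cone p <-> p.1 = 0 /\ 0 <= p.2.
Proof.
split=> [H|[p1 p2] l].
  split; last by have := H (0, 1) (mem_head _ _); rewrite /pdot/= dot0l add0r mul1r.
  apply/colP => i; rewrite mxE; apply/eqP; rewrite eq_le; apply/andP; split.
    have := H (- delta_mx i ord0, 0); rewrite /pdot/= dotNl dot_delta mul0r addr0.
    rewrite oppr_ge0; apply; rewrite inE mem_cat; apply/orP; right; apply/orP; right.
    by apply/mapP; exists i => //; rewrite mem_enum.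
  have := H (delta_mx i ord0, 0); rewrite /pdot/= dot_delta mul0r addr0.
  apply; rewrite inE mem_cat; apply/orP; right; apply/orP; left.
  by apply/mapP; exists i => //; rewrite mem_enum.
rewrite inE mem_cat /pdot p1 dot0r add0r => /or3P[/eqP ->|/mapP[i _ ->]|/mapP[i _ ->]].
- by rewrite mul1r.
- by rewrite mul0r.
- by rewrite mul0r.
Qed.

(** Adding the rays [(v i, 1)] to the base ray gives the cone over the hull of the [v i] and 0; the
    base ray accounts for the slack in the last coordinate. *)
Lemma in_foldr_add_ray (I : eqType) (v : I -> V) (s : seq I) p : uniq s ->
  in_cone (foldr (fun i L => add_ray L (v i, 1)) base_cone s) p <->
  exists w : I -> R, [/\ forall i, 0 <= w i, p.1 = \sum_(i <- s) w i *: v i &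
    \sum_(i <- s) w i <= p.2].
Proof.
elim: s p => [|i s IHs] p /=.
  move=> _; rewrite in_base_cone; split=> [[p1 p2]|[w [_ p1 p2]]].
    by exists (fun=> 0); split=> //; rewrite big_nil.
  by move: p1 p2; rewrite !big_nil.
move=> /andP[i_s us].
have sE (w : I -> R) t (W : nmodType) (F : R -> I -> W) :
    \sum_(j <- s) F (if j == i then t else w j) j = \sum_(j <- s) F (w j) j.
  by apply: eq_big_seq => j js; case: eqP => // ji; rewrite ji (negbTE i_s) in js.
rewrite in_add_ray; split=> [[t t0 /IHs[//|w [w0 /= w1 w2]]]|[w [w0 w1 w2]]].
  exists (fun j => if j == i then t else w j); split.
  - by move=> j; case: eqP.
  - rewrite big_cons eqxx (sE w t _ (fun a j => a *: v j)).
    by rewrite -w1 addrC subrK.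
  - rewrite big_cons eqxx (sE w t _ (fun a j => a)).
    by move: w2; rewrite /GRing.scale/= mulr1 lerBrDl.
exists (w i) => //; apply/IHs => //; exists w; split=> //.
- by rewrite /= w1 big_cons/= addrC addKr.
- by move: w2; rewrite /= big_cons /GRing.scale/= mulr1 lerBrDl.
Qed.

(** [P] is the section at height 1 of the cone spanned by [(0, 1)] and the [(v i, 1)]. *)
Lemma halfspace_rep (P : polytope0 R n) : exists L : seq (V * R),
  forall x, polytope_set P x <-> forall l, l \in L -> 0 <= dot l.1 x + l.2.
Proof.
have [k [v ->]] := polytope0_hull0 P.
exists (foldr (fun i L => add_ray L (v i, 1)) base_cone (enum 'I_k)) => x.
have := in_foldr_add_ray v (x, 1) (enum_uniq 'I_k).
rewrite /in_cone /pdot/= => xE; split=> [[w [w0 w1 w2]] l lL|xL].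
  have /xE/(_ _ lL) : exists w : 'I_k -> R, [/\ forall i, 0 <= w i,
      x = \sum_(i <- enum 'I_k) w i *: v i & \sum_(i <- enum 'I_k) w i <= 1].
    by exists w; rewrite !big_enum.
  by rewrite mulr1.
have /xE[w [w0]] : forall l, l \in
    foldr (fun i L => add_ray L (v i, 1)) base_cone (enum 'I_k) ->
    0 <= dot l.1 x + l.2 * 1.
  by move=> l /xL; rewrite mulr1.
by rewrite !big_enum => w1 w2; exists w.
Qed.

End halfspace_representation.

(** * Valuations that vanish on simplices *)

Section vanishing.
Context {R : realType} {n : nat}.
Local Notation V := 'cV[R]_n.
Implicit Types (P : polytope0 R n) (L E M : seq V) (s : seq (V * V)).
Variable Phi : polytope0 R n -> R.
Hypothesis val_Phi : is_valuation Phi.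
(** Linear independence is expressed by dual vectors, the form in which vertices are produced below;
    [j = 0] covers the polytope consisting of 0 alone. *)
Hypothesis Phi_simplex : forall j (u g : 'I_j -> V),
  (forall i k, dot (g i) (u k) = (i == k)%:R) -> Phi (poly_hull0 u) = 0.

(* The entries of [s] are pairs [(u_i, g_i)] of vertices and dual functionals. *)
Definition dual_pairs s := forall i j, (i < size s)%N -> (j < size s)%N ->
  dot (nth (0, 0) s i).2 (nth (0, 0) s j).1 = (i == j)%:R.

Definition vanish_on s L := forall h, h \in L -> forall p, p \in s -> dot h p.1 = 0.

Definition nonneg_on L (x : V) := forall h, h \in L -> 0 <= dot h x.

Definition zero_on E (x : V) := forall h, h \in E -> dot h x = 0.

Lemma nonneg_cons h L x : nonneg_on (h :: L) x <-> 0 <= dot h x /\ nonneg_on L x.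
Proof.
split=> [H|[h0 H] k]; last by rewrite inE => /orP[/eqP ->|/H].
by split=> [|k kL]; apply: H; rewrite inE ?eqxx// kL orbT.
Qed.

Lemma nonneg_cat L M x : nonneg_on (L ++ M) x <-> nonneg_on L x /\ nonneg_on M x.
Proof.
split=> [H|[HL HM] k]; last by rewrite mem_cat => /orP[/HL|/HM].
by split=> k kL; apply: H; rewrite mem_cat kL ?orbT.
Qed.

Lemma zero_cons h L x : zero_on (h :: L) x <-> dot h x = 0 /\ zero_on L x.
Proof.
split=> [H|[h0 H] k]; last by rewrite inE => /orP[/eqP ->|/H].
by split=> [|k kL]; apply: H; rewrite inE ?eqxx// kL orbT.
Qed.

Lemma vanish_cons h s L : vanish_on s (h :: L) <->
  (forall p, p \in s -> dot h p.1 = 0) /\ vanish_on s L.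
Proof.
split=> [H|[h0 H] k]; last by rewrite inE => /orP[/eqP ->|/H].
by split=> [|k kL]; apply: H; rewrite inE ?eqxx// kL orbT.
Qed.

(* The region left when the vertices in [s] have been split off. *)
Definition region (f : V) s L E (x : V) :=
  [/\ dot f x <= 1, forall p, p \in s -> 0 <= dot p.2 x, nonneg_on L x &
      zero_on E x].

Lemma Phi_cut P h :
  (forall Q, (forall x, polytope_set Q x <-> polytope_set P x /\ 0 <= dot h x) ->
    Phi Q = 0) ->
  (forall Q, (forall x, polytope_set Q x <-> polytope_set P x /\ dot h x <= 0) ->
    Phi Q = 0) ->
  (forall Q, (forall x, polytope_set Q x <-> polytope_set P x /\ dot h x = 0) ->
    Phi Q = 0) ->
  Phi P = 0.
Proof.
move=> H1 H2 H0.
have P1E x : polytope_set (polytope_cut h P) x <-> polytope_set P x /\ 0 <= dot h x.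
  by [].
have P2E x : polytope_set (polytope_cut (- h) P) x <->
    polytope_set P x /\ dot h x <= 0.
  by rewrite /= dotNl oppr_ge0.
have P0E x : polytope_set (polytope_cut h (polytope_cut (- h) P)) x <->
    polytope_set P x /\ dot h x = 0.
  rewrite /= dotNl oppr_ge0; split=> [[[Px h2] h1]|[Px ->]]; last by split.
  by split=> //; apply/eqP; rewrite eq_le h1 h2.
have := valuation_cut val_Phi P1E P2E P0E.
by rewrite (H1 _ P1E) (H2 _ P2E) (H0 _ P0E) !addr0.
Qed.

(** Subtract from a point of [P] its component along the vertices in [s]. If [f] is positive on the
    remainder [y], rescaling [y] contradicts [noB]; otherwise the ray through [y] stays in the
    bounded set [P], so [y = 0] and [P] is a simplex. *)
Lemma Phi_region_simplex P f s L E : dual_pairs s ->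
  (forall p, p \in s -> dot f p.1 = 1) -> vanish_on s L -> vanish_on s E ->
  (forall x, polytope_set P x <-> region f s L E x) ->
  (forall u, dot f u = 1 -> (forall p, p \in s -> dot p.2 u = 0) ->
     nonneg_on L u -> zero_on E u -> False) ->
  Phi P = 0.
Proof.
move=> ds fs Ls Es PE noB.
pose u (i : 'I_(size s)) := (nth (0, 0) s i).1.
pose g (i : 'I_(size s)) := (nth (0, 0) s i).2.
have gu i k : dot (g i) (u k) = (i == k)%:R by rewrite ds.
have sP p : p \in s -> exists i : 'I_(size s), p = (u i, g i).
  move=> /(nthP (0, 0))[i si <-]; exists (Ordinal si).
  by rewrite /u /g/= -surjective_pairing.
have us i : (u i, g i) \in s by rewrite -surjective_pairing mem_nth.
have fu i : dot f (u i) = 1 by rewrite (fs _ (us i)).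
have gsum (w : 'I_(size s) -> R) k : dot (g k) (\sum_i w i *: u i) = w k.
  rewrite dot_sumr (bigD1 k)//= big1 => [|i ik].
    by rewrite dotZr gu eqxx mulr1 addr0.
  by rewrite dotZr gu eq_sym (negbTE ik) mulr0.
have hsum h (w : 'I_(size s) -> R) : (forall p, p \in s -> dot h p.1 = 0) ->
    dot h (\sum_i w i *: u i) = 0.
  move=> h0; rewrite dot_sumr big1// => i _.
  by rewrite dotZr (h0 _ (us i)) mulr0.
have fsum (w : 'I_(size s) -> R) : dot f (\sum_i w i *: u i) = \sum_i w i.
  by rewrite dot_sumr; apply: eq_bigr => i _; rewrite dotZr fu mulr1.
suff -> : P = poly_hull0 u by exact: (Phi_simplex gu).
apply: polytope0_inj; apply/seteqP; split=> x /=; last first.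
  move=> [w [w0 w1 ->]]; apply/PE; split.
  - by rewrite fsum.
  - by move=> p /sP[i ->] /=; rewrite gsum.
  - by move=> h hL; rewrite hsum// => p; exact: Ls.
  - by move=> h hE; rewrite hsum// => p; exact: Es.
move=> /PE[fx gx Lx Ex].
pose y := x - \sum_i dot (g i) x *: u i.
have gy p : p \in s -> dot p.2 y = 0.
  by move=> /sP[i ->] /=; rewrite dotBr gsum subrr.
have Ly h : h \in L -> dot h y = dot h x.
  by move=> hL; rewrite dotBr hsum ?subr0// => p; exact: Ls.
have Ey h : h \in E -> dot h y = 0.
  by move=> hL; rewrite dotBr hsum ?subr0 ?Ex// => p; exact: Es.
have [fy|fy] := ltP 0 (dot f y).
  exfalso; apply: (noB ((dot f y)^-1 *: y)).
  - by rewrite dotZr mulVf// gt_eqF.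
  - by move=> p ps; rewrite dotZr gy// mulr0.
  - move=> h hL; rewrite dotZr (Ly h)//.
    by apply: mulr_ge0; [rewrite invr_ge0 ltW|exact: Lx].
  - by move=> h hE; rewrite dotZr (Ey h)// mulr0.
have y0 : y = 0.
  apply: (@polytope0_recession _ _ P) => c c0; apply/PE; split.
  - by rewrite dotZr (le_trans _ ler01)// mulr_ge0_le0.
  - by move=> p ps; rewrite dotZr gy// mulr0.
  - by move=> h hL; rewrite dotZr Ly//; apply: mulr_ge0 => //; exact: Lx.
  - by move=> h hE; rewrite dotZr (Ey h)// mulr0.
have xE : x = \sum_i dot (g i) x *: u i by apply/eqP; rewrite -subr_eq0 -/y y0.
exists (fun i => dot (g i) x); split=> //.
  by move=> i; exact: (gx _ (us i)).
by rewrite -fsum -xE.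
Qed.

(* [N] bounds the number of inequalities: splitting off a vertex [u] of the
   region uses up one of them, after the functionals in [M] (those positive at
   [u]) have been compared by cuts along their differences, which vanish at [u]. *)
Lemma Phi_region_vertex N : (forall P f s L E, (size L < N)%N -> dual_pairs s ->
    (forall p, p \in s -> dot f p.1 = 1) -> vanish_on s L -> vanish_on s E ->
    (forall x, polytope_set P x <-> region f s L E x) -> Phi P = 0) ->
  forall f s u, dual_pairs s -> (forall p, p \in s -> dot f p.1 = 1) ->
  dot f u = 1 -> (forall p, p \in s -> dot p.2 u = 0) ->
  forall M L E P, (size M + size L <= N)%N ->
  vanish_on s M -> vanish_on s L -> vanish_on s E ->
  (forall h, h \in M -> dot h u = 1) -> zero_on L u -> zero_on E u ->
  (forall x, polytope_set P x <-> region f s (M ++ L) E x) -> Phi P = 0.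
Proof.
move=> IH f s u ds fs fu su M; have [m] := ubnP (size M).
elim: m M => // m IHM [|h [|k M]] sM L E P sML Ms Ls Es Mu Lu Eu PE.
(* With no form positive at [u], the ray through [- u] lies in [P], against boundedness. *)
- suff : u = 0 by move=> u0; move: fu; rewrite u0 dot0r => /eqP; rewrite eq_sym oner_eq0.
  apply/eqP; rewrite -oppr_eq0; apply/eqP.
  apply: (@polytope0_recession _ _ P) => c c0; apply/PE; split.
  + by rewrite dotZr dotNr fu mulrN1 (le_trans _ ler01)// oppr_le0.
  + by move=> p ps; rewrite dotZr dotNr su// oppr0 mulr0.
  + by move=> h hL; rewrite dotZr dotNr Lu// oppr0 mulr0.
  + by move=> h hE; rewrite dotZr dotNr Eu// oppr0 mulr0.
(* The single remaining [h] is dual to [u], so [(u, h)] joins [s] and [L] is left with fewer than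
   [N] inequalities. *)
- move/vanish_cons : Ms => [hs _].
  have hu : dot h u = 1 by apply: Mu; rewrite mem_head.
  apply: (IH P f ((u, h) :: s) L E) => //.
  + move=> [|i] [|j]//=; rewrite ?eqSS.
    * by move=> _ js; apply: hs; exact: mem_nth.
    * by move=> ls _; apply: su; exact: mem_nth.
    * by rewrite !ltnS => li lj; exact: ds.
  + by move=> p; rewrite inE => /orP[/eqP ->//|/fs].
  + by move=> a aL p; rewrite inE => /orP[/eqP ->|]; [exact: Lu|exact: Ls].
  + by move=> a aL p; rewrite inE => /orP[/eqP ->|]; [exact: Eu|exact: Es].
  + move=> x; rewrite PE; split=> [[fx sx /nonneg_cons[hx Lx] Ex]|[fx sx Lx Ex]].
      by split=> // p; rewrite inE => /orP[/eqP ->|/sx].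
    split=> //; first by move=> p ps; apply: sx; rewrite inE ps orbT.
    by apply/nonneg_cons; split=> //; apply: (sx (u, h)); rewrite mem_head.
move: Ms => /vanish_cons[hs /vanish_cons[ks Ms]].
have hu : dot h u = 1 by apply: Mu; rewrite mem_head.
have ku : dot k u = 1 by apply: Mu; rewrite !inE eqxx orbT.
have {}Mu a : a \in M -> dot a u = 1 by move=> aM; apply: Mu; rewrite !inE aM !orbT.
have du : dot (h - k) u = 0 by rewrite dotBl hu ku subrr.
have dsv p : p \in s -> dot (h - k) p.1 = 0.
  by move=> ps; rewrite dotBl hs// ks// subrr.
have d'u : dot (k - h) u = 0 by rewrite dotBl hu ku subrr.
have d'sv p : p \in s -> dot (k - h) p.1 = 0.
  by move=> ps; rewrite dotBl hs// ks// subrr.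
(* On the side [k <= h] the inequality [0 <= h] follows from [0 <= k]; it gives way to [0 <= h - k],
   which vanishes at [u] and goes to [L]. The other side is symmetric. On the hyperplane [h - k]
   becomes an equation and [k] is dropped. *)
apply: (@Phi_cut P (h - k)) => Q QE.
- apply: (IHM (k :: M) _ ((h - k) :: L) E) => //.
  + by move: sML; rewrite /= !addSn !addnS.
  + by apply/vanish_cons.
  + by apply/vanish_cons.
  + by move=> a; rewrite inE => /orP[/eqP ->//|/Mu].
  + by apply/zero_cons.
  + move=> x; rewrite QE PE; split.
      move=> [[fx sx /nonneg_cons[hx /nonneg_cons[kx /nonneg_cat[Mx Lx]]] Ex] dx].
      split=> //; apply/nonneg_cons; split=> //; apply/nonneg_cat; split=> //.
      by apply/nonneg_cons.
    move=> [fx sx /nonneg_cons[kx /nonneg_cat[Mx /nonneg_cons[dx Lx]]] Ex].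
    split=> //; split=> //; apply/nonneg_cons; split.
      by move: dx; rewrite dotBl; lra.
    by apply/nonneg_cons; split=> //; apply/nonneg_cat.
- apply: (IHM (h :: M) _ ((k - h) :: L) E) => //.
  + by move: sML; rewrite /= !addSn !addnS.
  + by apply/vanish_cons.
  + by apply/vanish_cons.
  + by move=> a; rewrite inE => /orP[/eqP ->//|/Mu].
  + by apply/zero_cons.
  + move=> x; rewrite QE PE; split.
      move=> [[fx sx /nonneg_cons[hx /nonneg_cons[kx /nonneg_cat[Mx Lx]]] Ex] dx].
      split=> //; apply/nonneg_cons; split=> //; apply/nonneg_cat; split=> //.
      by apply/nonneg_cons; split=> //; move: dx; rewrite !dotBl; lra.
    move=> [fx sx /nonneg_cons[hx /nonneg_cat[Mx /nonneg_cons[dx Lx]]] Ex].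
    split; last by move: dx; rewrite !dotBl; lra.
    split=> //; apply/nonneg_cons; split=> //; apply/nonneg_cons; split.
      by move: dx; rewrite dotBl; lra.
    by apply/nonneg_cat.
- apply: (IHM (h :: M) _ L ((h - k) :: E)) => //.
  + by move: sML; rewrite /= !addSn => /ltnW.
  + by apply/vanish_cons.
  + by apply/vanish_cons.
  + by move=> a; rewrite inE => /orP[/eqP ->//|/Mu].
  + by apply/zero_cons.
  + move=> x; rewrite QE PE; split.
      move=> [[fx sx /nonneg_cons[hx /nonneg_cons[kx /nonneg_cat[Mx Lx]]] Ex] dx].
      split=> //; last by apply/zero_cons.
      by apply/nonneg_cons; split=> //; apply/nonneg_cat.
    move=> [fx sx /nonneg_cons[hx /nonneg_cat[Mx Lx]] /zero_cons[dx Ex]].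
    split=> //; split=> //; apply/nonneg_cons; split=> //; apply/nonneg_cons; split.
      by move: dx; rewrite dotBl; lra.
    by apply/nonneg_cat.
Qed.

Lemma Phi_region P f s L E : dual_pairs s ->
  (forall p, p \in s -> dot f p.1 = 1) -> vanish_on s L -> vanish_on s E ->
  (forall x, polytope_set P x <-> region f s L E x) -> Phi P = 0.
Proof.
have [N] := ubnP (size L).
elim: N P f s L E => // N IHN P f s L E sL ds fs Ls Es PE.
have [[u [fu su Lu Eu]]|noB] := pselect (exists u, [/\ dot f u = 1,
    forall p, p \in s -> dot p.2 u = 0, nonneg_on L u & zero_on E u]); last first.
  apply: (Phi_region_simplex ds fs Ls Es PE) => u fu su Lu Eu; apply: noB.
  by exists u.
(* Forms of [L] that are not positive at [u] vanish there, since [u] satisfies all of [L]; the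
   positive ones are scaled to the value 1 at [u]. *)
pose pos h := 0 < dot h u.
apply: (Phi_region_vertex IHN ds fs fu su
  (M := [seq (dot h u)^-1 *: h | h <- L & pos h])
  (L := [seq h <- L | ~~ pos h]) (E := E)) => //.
- by rewrite size_map !size_filter count_predC.
- move=> h /mapP[k]; rewrite mem_filter => /andP[_ kL] -> p ps.
  by rewrite dotZl (Ls _ kL)// mulr0.
- by move=> h; rewrite mem_filter => /andP[_ hL]; exact: Ls.
- move=> h /mapP[k]; rewrite mem_filter => /andP[k0 _] ->.
  by rewrite dotZl mulVf// gt_eqF.
- move=> h; rewrite mem_filter /pos -leNgt => /andP[h0 hL].
  by apply/eqP; rewrite eq_le h0; exact: Lu.
- move=> x; rewrite PE; split=> -[fx sx Lx Ex]; split=> //.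
    apply/nonneg_cat; split=> h.
      move=> /mapP[k]; rewrite mem_filter => /andP[k0 kL] ->.
      by rewrite dotZl; apply: mulr_ge0; [rewrite invr_ge0 ltW|exact: Lx].
    by rewrite mem_filter => /andP[_]; exact: Lx.
  move: Lx => /nonneg_cat[Mx Lx] h hL; have [h0|h0] := boolP (pos h); last first.
    by apply: Lx; rewrite mem_filter h0.
  rewrite -(pmulr_rge0 _ (_ : 0 < (dot h u)^-1)) ?invr_gt0// -dotZl; apply: Mx.
  by apply/mapP; exists h => //; rewrite mem_filter h0.
Qed.

(** After a cut along [f - g], one of the caps [f <= 1] and [g <= 1] implies the other on each
    piece, so every cut removes a cap until one is left. *)
Lemma Phi_cone_caps P f F L E :
  (forall x, polytope_set P x <->
    [/\ forall g, g \in f :: F -> dot g x <= 1, nonneg_on L x & zero_on E x]) ->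
  Phi P = 0.
Proof.
elim: F P f L E => [|g F IHF] P f L E PE.
  apply: (@Phi_region P f [::] L E) => // x; rewrite PE; split.
    by move=> [fx Lx Ex]; split=> //; apply: fx; rewrite mem_head.
  by move=> [fx _ Lx Ex]; split=> // g; rewrite inE => /eqP ->.
have capsP a b x : (forall c, c \in [:: a, b & F] -> dot c x <= 1) <->
    dot b x <= 1 /\ (forall c, c \in a :: F -> dot c x <= 1).
  split=> [H|[ax H] c].
    split; first by apply: H; rewrite !inE eqxx orbT.
    by move=> c; rewrite inE => cF; apply: H; rewrite !inE; case/orP : cF => ->;
      rewrite ?orbT.
  rewrite !inE => /or3P[/eqP ->|/eqP ->//|cF]; apply: H; rewrite inE ?eqxx//.
  by rewrite cF orbT.
have capsC x : (forall c, c \in [:: f, g & F] -> dot c x <= 1) <->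
    (forall c, c \in [:: g, f & F] -> dot c x <= 1).
  by split=> H c cF; apply: H; move: cF; rewrite !inE orbCA.
have headP a x : (forall c, c \in a :: F -> dot c x <= 1) -> dot a x <= 1.
  by apply; rewrite mem_head.
apply: (@Phi_cut P (f - g)) => Q QE.
- apply: (IHF Q f ((f - g) :: L) E) => x; rewrite QE PE; split.
    by move=> [[/capsP[_ fx] Lx Ex] dx]; split=> //; apply/nonneg_cons.
  move=> [fx /nonneg_cons[dx Lx] Ex]; split=> //; split=> //; apply/capsP.
  by split=> //; move: dx (headP _ _ fx); rewrite dotBl; lra.
- apply: (IHF Q g ((g - f) :: L) E) => x; rewrite QE PE; split.
    move=> [[/capsC/capsP[_ fx] Lx Ex] dx]; split=> //; apply/nonneg_cons; split=> //.
    by move: dx; rewrite !dotBl; lra.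
  move=> [fx /nonneg_cons[dx Lx] Ex]; split; last by move: dx; rewrite !dotBl; lra.
  split=> //; apply/capsC/capsP.
  by split=> //; move: dx (headP _ _ fx); rewrite dotBl; lra.
- apply: (IHF Q f L ((f - g) :: E)) => x; rewrite QE PE; split.
    by move=> [[/capsP[_ fx] Lx Ex] dx]; split=> //; apply/zero_cons.
  move=> [fx Lx /zero_cons[dx Ex]]; split=> //; split=> //; apply/capsP.
  by split=> //; move: dx (headP _ _ fx); rewrite dotBl; lra.
Qed.

Theorem valuation_vanishing P : Phi P = 0.
Proof.
have [K PK] := halfspace_rep P.
have K0 l : l \in K -> 0 <= l.2.
  by move=> lK; have /PK/(_ _ lK) := polytope_origin P; rewrite dot0r add0r.
(* Constants are nonnegative because 0 lies in [P]: positive ones are normalised into caps, zero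
   ones give cone inequalities. The trivial cap 0 ensures that there is at least one cap. *)
apply: (@Phi_cone_caps P 0 [seq - (l.2^-1 *: l.1) | l <- K & 0 < l.2]
  [seq l.1 | l <- K & ~~ (0 < l.2)] [::]) => x; rewrite PK; split.
  move=> Kx; split=> // g.
    rewrite inE => /orP[/eqP ->|/mapP[l]]; first by rewrite dot0l.
    rewrite mem_filter => /andP[l0 /Kx lx] ->.
    by rewrite dotNl dotZl mulrC -mulNr ler_pdivrMr// mul1r; lra.
  move=> /mapP[l]; rewrite mem_filter -leNgt => /andP[l0 lK] ->.
  by move: (Kx _ lK); rewrite (_ : l.2 = 0) ?addr0//; apply/eqP; rewrite eq_le l0 K0.
move=> [Fx Lx _] l lK; have [l0|l0] := boolP (0 < l.2); last first.
  apply: addr_ge0 (K0 _ lK); apply: Lx; apply/mapP; exists l => //.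
  by rewrite mem_filter l0.
have : dot (- (l.2^-1 *: l.1)) x <= 1.
  by apply: Fx; rewrite inE; apply/orP; right; apply/mapP; exists l => //;
    rewrite mem_filter l0.
by rewrite dotNl dotZl mulrC -mulNr ler_pdivrMr// mul1r; lra.
Qed.

End vanishing.

(** * Volume *)

Section lebesgue_columns.
Context {R : realType}.
Local Notation T := (measurableTypeR R).

(** Polytopes consist of columns while the product measure lives on tuples; [tset] translates, and
    [lebn] is the volume before [fine]. *)
Definition tset n (X : set 'cV[R]_n) : set (n.-tuple T) :=
  [set t | X (\col_i tnth t i)].

Definition lebn n (X : set 'cV[R]_n) : \bar R := lebesgue_tuple n (tset X).

Definition mset n (X : set 'cV[R]_n) : Prop := measurable (tset X).

Lemma volumeE n (X : set 'cV[R]_n) : volume X = fine (lebn X).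
Proof. by []. Qed.

Lemma col_tuple_cons n (x : T) (t : n.-tuple T) :
  \col_i tnth [the n.+1.-tuple T of x :: t] i =
  col_mx (x : R)%:M (\col_i tnth t i) :> 'cV[R]_(1 + n).
Proof.
apply/colP => i; rewrite mxE; case: (@split_ordP 1 n i) => j ->.
  by rewrite col_mxEu ord1 mxE eqxx mulr1n.
by rewrite col_mxEd mxE !(tnth_nth 0).
Qed.

Lemma mset_comp d (S : measurableType d) n (f : S -> 'cV[R]_n) X :
  (forall i, measurable_fun setT (fun s => f s i ord0 : T)) ->
  mset X -> measurable [set s | X (f s)].
Proof.
move=> mf mX; pose g s := [tuple (f s i ord0 : T) | i < n].
have mg : measurable_fun setT g.
  apply/measurable_fun_tnthP => i.
  by rewrite (_ : _ \o _ = fun s => f s i ord0)//; apply/funext => s;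
    rewrite /= tnth_mktuple.
have := mg measurableT _ mX; rewrite setTI; congr measurable.
apply/seteqP; split=> s; rewrite /= /tset/=; congr (X _); apply/colP => i;
  by rewrite mxE tnth_mktuple.
Qed.

Lemma measurable_coord n i :
  measurable_fun setT (fun t : n.-tuple T => (\col_i tnth t i : 'cV[R]_n) i ord0 : T).
Proof.
under [X in measurable_fun _ X]eq_fun do rewrite mxE.
exact: measurable_tnth.
Qed.

Lemma measurable_dot n (a : 'cV[R]_n) :
  measurable_fun setT (fun t : n.-tuple T => dot a (\col_i tnth t i) : T).
Proof.
rewrite /dot; apply: measurable_sum => i; apply: measurable_funM.
  exact: measurable_cst.
exact: measurable_coord.
Qed.

Lemma mset_affine m n (M : 'M[R]_(m, n)) (b : 'cV[R]_m) X :
  mset X -> mset [set y | X (M *m y + b)].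
Proof.
move=> mX; apply: (@mset_comp _ _ m (fun t : n.-tuple T => M *m (\col_i tnth t i) + b)) => // i.
rewrite (_ : (fun _ => _) =
  (fun t : n.-tuple T => dot (row i M)^T (\col_i tnth t i) + b i ord0)).
  apply: measurable_funD; [exact: measurable_dot|exact: measurable_cst].
apply/funext => t; rewrite !mxE; congr (_ + _); apply: eq_bigr => j _.
by rewrite !mxE.
Qed.

Lemma mset_linear m n (M : 'M[R]_(m, n)) X : mset X -> mset [set y | X (M *m y)].
Proof.
move=> /(mset_affine M 0); congr mset.
by apply/seteqP; split=> y /=; rewrite addr0.
Qed.

Lemma msetI n (X Y : set 'cV[R]_n) : mset X -> mset Y -> mset (X `&` Y).
Proof. exact: measurableI. Qed.

Lemma msetU n (X Y : set 'cV[R]_n) : mset X -> mset Y -> mset (X `|` Y).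
Proof. exact: measurableU. Qed.

Lemma mset_halfspace n (a : 'cV[R]_n) c : mset [set x | c <= dot a x].
Proof.
have := measurable_dot a measurableT (@measurable_itv R `[c, +oo[).
rewrite setTI; congr measurable; apply/seteqP.
by split=> t; rewrite /= in_itv/= andbT.
Qed.

Lemma mset_hyperplane n (a : 'cV[R]_n) c : mset [set x | dot a x = c].
Proof.
have := measurable_dot a measurableT (@measurable_set1 R c).
by rewrite setTI.
Qed.

Lemma mset_halfspaces n (K : seq ('cV[R]_n * R)) (c : 'cV[R]_n * R -> R) :
  mset [set x | forall l, l \in K -> c l <= dot l.1 x + l.2].
Proof.
elim: K => [|k K IHK].
  rewrite (_ : [set _ | _] = setT); first exact: measurableT.
  by apply/seteqP; split.
rewrite (_ : [set _ | _] = [set x | c k - k.2 <= dot k.1 x] `&`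
    [set x | forall l, l \in K -> c l <= dot l.1 x + l.2]).
  by apply: msetI => //; exact: mset_halfspace.
apply/seteqP; split=> x /= => [H|[hk H] l].
  split; first by rewrite lerBlDr; apply: H; rewrite mem_head.
  by move=> l lK; apply: H; rewrite inE lK orbT.
by rewrite inE => /orP[/eqP ->|/H//]; rewrite -lerBlDr.
Qed.

Lemma mset_polytope n (P : polytope0 R n) : mset (polytope_set P).
Proof.
have [K PK] := halfspace_rep P; have := mset_halfspaces K (fun=> 0).
by congr mset; apply/seteqP; split=> x /PK.
Qed.

Lemma lebn_sectionl n (X : set 'cV[R]_(1 + n)) :
  lebn X = (\int[@lebesgue_measure R]_x lebn [set y | X (col_mx (x : R)%:M y)])%E.
Proof.
rewrite /lebn/= /lebesgue_step /pushforward /product_measure1.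
apply: eq_integral => x _ /=; congr (lebesgue_tuple n _).
by rewrite xsectionE; apply/seteqP; split=> t; rewrite /tset/= col_tuple_cons.
Qed.

(** Tonelli with the first coordinate innermost: both iterated measures agree on rectangles, hence
    on measurable sets. *)
Lemma lebn_sectionr n (X : set 'cV[R]_(1 + n)) : mset X ->
  lebn X = (\int[lebesgue_tuple n]_t
    @lebesgue_measure R [set x : T | X (col_mx (x : R)%:M (\col_i tnth t i))])%E.
Proof.
move=> mX; rewrite /lebn/= /lebesgue_step /pushforward.
rewrite (@product_measure_unique _ _ _ _ _ _ _
  (@lebesgue_measure R \x^ lebesgue_tuple n)%E).
- rewrite /product_measure2.
  apply: eq_integral => t _ /=; congr (lebesgue_measure _).
  by rewrite ysectionE; apply/seteqP; split=> x; rewrite /tset/= col_tuple_cons.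
- by move=> A B mA mB /=; rewrite product_measure2E.
- by rewrite -[X in measurable X]setTI; exact: measurable_cons_pair.
Qed.

Lemma lebesgue_translate (c : R) (A : set T) : measurable A ->
  lebesgue_measure [set x : T | A (x + c)] = lebesgue_measure A.
Proof.
move=> mA.
have mc : measurable_fun setT (fun x : T => x + c : T).
  by apply: measurable_funD; [exact: measurable_id|exact: measurable_cst].
apply/esym; have := @lebesgue_measure_unique R
  (pushforward (@lebesgue_measure R) (fun x : T => x + c : T)).
apply => // _ [[a b]] _ <-.
transitivity (lebesgue_measure (`]a - c, b - c]%classic : set T)).
  rewrite !lebesgue_measure_itv/= !lte_fin ltrD2r; case: ifP => // _.
  by rewrite -!EFinB; congr EFin; ring.
congr lebesgue_measure.
by apply/seteqP; split=> x /=; rewrite !in_itv/= ltrBlDr lerBrDr.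
Qed.

Lemma mset_sectionl n (X : set 'cV[R]_(1 + n)) (x : R) :
  mset X -> mset [set y | X (col_mx x%:M y)].
Proof.
move=> /(mset_affine (col_mx 0 1%:M) (col_mx x%:M 0)); congr mset.
by apply/seteqP; split=> y /=; rewrite mul_col_mx mul0mx mul1mx add_col_mx add0r addr0.
Qed.

Lemma measurable_sectionr n (X : set 'cV[R]_(1 + n)) (y : 'cV[R]_n) :
  mset X -> measurable [set x : T | X (col_mx (x : R)%:M y)].
Proof.
move=> mX; apply: mset_comp mX => i.
case: (@split_ordP 1 n i) => j -> .
  under [X in measurable_fun _ X]eq_fun do rewrite col_mxEu ord1 mxE eqxx mulr1n.
  exact: measurable_id.
under [X in measurable_fun _ X]eq_fun do rewrite col_mxEd.
exact: measurable_cst.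
Qed.

Lemma scalar_mx11D (x : R) (M : 'M[R]_1) : x%:M + M = (x + M ord0 ord0)%:M.
Proof. by apply/matrixP => i j; rewrite !ord1 !mxE. Qed.

(** By induction: the last coordinates of [b] translate the sections with fixed first coordinate,
    and its first coordinate translates the lines parallel to the first axis. *)
Lemma lebn_translate n (X : set 'cV[R]_n) b : mset X ->
  lebn [set y | X (y + b)] = lebn X.
Proof.
elim: n X b => [|n IHn] X b mX.
  by congr lebn; apply/seteqP; split=> y /=; rewrite (flatmx0 b) addr0.
have -> : b = col_mx (usubmx (b : 'cV[R]_(1 + n))) (dsubmx (b : 'cV[R]_(1 + n))).
  by rewrite vsubmxK.
set b0 := usubmx _; set b1 := dsubmx _; clearbody b0 b1.
transitivity (lebn [set z : 'cV[R]_(1 + n) | X (z + col_mx b0 0)]).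
  rewrite !lebn_sectionl; apply: eq_integral => x _.
  rewrite -[RHS](IHn _ b1); first congr lebn.
    by apply/seteqP; split=> y /=; rewrite !add_col_mx !addr0 -add_col_mx.
  have := mset_sectionl x (mset_affine 1%:M (col_mx b0 0) mX).
  by congr mset; apply/seteqP; split=> y /=; rewrite mul1mx.
rewrite !lebn_sectionr//; last first.
  have := mset_affine 1%:M (col_mx b0 0 : 'cV[R]_(1 + n)) mX.
  by congr mset; apply/seteqP; split=> y /=; rewrite mul1mx.
apply: eq_integral => t _.
rewrite -[RHS](lebesgue_translate (b0 ord0 ord0)); last exact: measurable_sectionr.
congr lebesgue_measure; apply/seteqP.
by split=> x /=; rewrite add_col_mx addr0 scalar_mx11D.
Qed.

Definition leb_invariant n (A : 'M[R]_n) :=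
  forall X, mset X -> lebn [set y | X (A *m y)] = lebn X.

Lemma leb_invariantM n (A B : 'M[R]_n) :
  leb_invariant A -> leb_invariant B -> leb_invariant (A *m B).
Proof.
move=> iA iB X mX; rewrite -(iA _ mX) -(iB _ (mset_linear A mX)).
by congr lebn; apply/seteqP; split=> y /=; rewrite mulmxA.
Qed.

(** This shear translates each line parallel to the first axis along itself; the transposed shear
    below translates the sections with fixed first coordinate. *)
Lemma leb_invariant_ur n (r : 'rV[R]_n) :
  leb_invariant (block_mx 1%:M r 0 1%:M : 'M[R]_(1 + n)).
Proof.
move=> X mX; rewrite !lebn_sectionr//; last exact: mset_linear.
apply: eq_integral => t _; set y := \col_i tnth t i.
rewrite -[RHS](lebesgue_translate ((r *m y) ord0 ord0)); last exact: measurable_sectionr.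
congr lebesgue_measure; apply/seteqP.
by split=> x /=; rewrite mul_block_col !mul1mx mul0mx add0r
  scalar_mx11D.
Qed.

Lemma leb_invariant_dl n (c : 'cV[R]_n) :
  leb_invariant (block_mx 1%:M 0 c 1%:M : 'M[R]_(1 + n)).
Proof.
move=> X mX; rewrite !lebn_sectionl; apply: eq_integral => x _.
rewrite -[RHS](lebn_translate (x *: c)); last exact: mset_sectionl.
congr lebn; apply/seteqP.
by split=> y /=; rewrite mul_block_col !mul1mx mul0mx addr0 mul_mx_scalar addrC.
Qed.

Lemma leb_invariant_dr n (D : 'M[R]_n) : leb_invariant D ->
  leb_invariant (block_mx 1%:M 0 0 D : 'M[R]_(1 + n)).
Proof.
move=> iD X mX; rewrite !lebn_sectionl; apply: eq_integral => x _.
rewrite -[RHS]iD; last exact: mset_sectionl.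
congr lebn; apply/seteqP.
by split=> y /=; rewrite mul_block_col !mul1mx !mul0mx addr0 add0r.
Qed.

(** Block elimination: shears bring the top left entry to 1, and then the matrix is a product of
    shears and a block with a Schur complement of determinant 1, treated by induction. *)
Lemma leb_invariant_SL n (A : 'M[R]_n) : \det A = 1 -> leb_invariant A.
Proof.
elim: n A => [|n IHn] A detA.
  move=> X mX; congr lebn; apply/seteqP.
  by split=> y /=; rewrite (flatmx0 (A *m y)) (flatmx0 y).
move: A detA; rewrite -[n.+1]/(1 + n)%N => A detA.
have urK (r : 'rV[R]_n) : block_mx 1%:M (- r) 0 1%:M *m block_mx 1%:M r 0 1%:M = 1%:M :> 'M[R]_(1 + n).
  by rewrite mulmx_block !mul1mx !mulmx1 !mulmx0 !mul0mx !addr0 add0r addrN -scalar_mx_block.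
have dlK (c : 'cV[R]_n) : block_mx 1%:M 0 (- c) 1%:M *m block_mx 1%:M 0 c 1%:M = 1%:M :> 'M[R]_(1 + n).
  by rewrite mulmx_block !mul1mx !mulmx1 !mulmx0 !mul0mx !addr0 add0r addNr -scalar_mx_block.
have case1 (B : 'M[R]_(1 + n)) : \det B = 1 -> ulsubmx B = 1%:M -> leb_invariant B.
  move=> detB B1.
  have BE : B = block_mx 1%:M 0 (dlsubmx B) 1%:M *m
      (block_mx 1%:M 0 0 (drsubmx B - dlsubmx B *m ursubmx B) *m
       block_mx 1%:M (ursubmx B) 0 1%:M).
    rewrite !mulmx_block !mul1mx !mulmx1 !mulmx0 !mul0mx !addr0 !add0r.
    by rewrite addrC subrK mulmx1 -B1 submxK.
  rewrite BE; apply: leb_invariantM; first exact: leb_invariant_dl.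
  apply: leb_invariantM; last exact: leb_invariant_ur.
  apply: leb_invariant_dr; apply: IHn.
  move: detB; rewrite {1}BE.
  by rewrite !det_mulmx det_lblock !det_ublock !det1 !mul1r !mulr1.
have case2 (B : 'M[R]_(1 + n)) : \det B = 1 -> dlsubmx B != 0 -> leb_invariant B.
  move=> detB /cV0Pn[i ci].
  (* Adding this multiple of row [i] of the lower block to the first row makes the top left entry
     1. *)
  pose r : 'rV[R]_n := ((1 - ulsubmx B ord0 ord0) / dlsubmx B i ord0) *: delta_mx ord0 i.
  rewrite -[B]mul1mx -(urK r) -mulmxA; apply: leb_invariantM.
    exact: leb_invariant_ur.
  apply: case1; first by rewrite det_mulmx detB det_ublock !det1 !mulr1.
  rewrite -[X in _ *m X]submxK mulmx_block block_mxKul mul1mx.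
  have -> : r *m dlsubmx B = (1 - ulsubmx B ord0 ord0)%:M.
    rewrite -scalemxAl -rowE; apply/matrixP => a b; rewrite !ord1.
    by rewrite [LHS]mxE [X in _ * X]mxE divfK// [RHS]mxE mulr1n.
  by rewrite addrC scalar_mx11D subrK.
have [c0|] := eqVneq (dlsubmx A) 0; last exact: case2.
have [n0|/eqP] := eqVneq n 0%N.
  apply: case1 => //; subst n.
  apply/matrixP => i j; rewrite !ord1 !mxE eqxx -[RHS]detA det_mx11.
  by congr (A _ _); apply: val_inj.
move=> /eqP; rewrite -lt0n => n0.
(* The first column is zero below its top entry, which is nonzero because [\det A = 1]; adding the
   first row to all others leads to [case2]. *)
pose c : 'cV[R]_n := const_mx 1.
rewrite -[A]mul1mx -(dlK c) -mulmxA; apply: leb_invariantM.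
  exact: leb_invariant_dl.
apply: case2; first by rewrite det_mulmx detA det_lblock !det1 !mulr1.
rewrite -[X in _ *m X]submxK mulmx_block block_mxKdl c0 mulmx0 addr0.
apply/cV0Pn; exists (Ordinal n0).
rewrite (mx11_scalar (ulsubmx _)) mul_mx_scalar !mxE mulr1.
apply/eqP => a0; move: detA; rewrite -[X in \det X]submxK c0 det_ublock.
by rewrite (mx11_scalar (ulsubmx _)) !mxE a0 det_scalar expr1 mul0r => /eqP;
  rewrite eq_sym oner_eq0.
Qed.

End lebesgue_columns.

(** * Volume as an SL(n) invariant valuation, and its null sets *)

Section volume_facts.
Context {R : realType}.
Local Notation T := (measurableTypeR R).

Lemma dot_col_mx n (a : 'cV[R]_(1 + n)) (x : R) (y : 'cV[R]_n) :
  dot a (col_mx x%:M y) = a ord0 ord0 * x + dot (dsubmx a) y.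
Proof.
rewrite /dot big_split_ord/=.
rewrite big_ord1 col_mxEu mxE mulr1n; congr (_ * _ + _).
  by congr (a _ _); apply: val_inj.
by apply: eq_bigr => i _; rewrite col_mxEd mxE.
Qed.

(** If the first coefficient is nonzero, lines parallel to the first axis meet the hyperplane in
    single points; otherwise its sections with fixed first coordinate are hyperplanes one dimension
    lower. *)
Lemma lebn_hyperplane n (a : 'cV[R]_n) c : a != 0 ->
  lebn [set x | dot a x = c] = 0%E.
Proof.
elim: n a c => [|n IHn] a c a0; first by rewrite (flatmx0 a) eqxx in a0.
have [a00|a00] := eqVneq (a ord0 ord0) 0.
  rewrite (lebn_sectionl [set x : 'cV[R]_(1 + n) | dot a x = c]).
  apply: integral0_eq => x _.
  rewrite -[RHS](IHn (dsubmx (a : 'cV[R]_(1 + n))) c).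
    congr lebn; apply/seteqP.
    by split=> y /=; rewrite dot_col_mx a00 mul0r add0r.
  apply: contra a0 => /eqP a'0; apply/eqP.
  apply/colP => i; rewrite mxE; case: (@split_ordP 1 n i) => j ->.
    by rewrite ord1 -[RHS]a00; congr (a _ _); apply: val_inj.
  by have := congr1 (fun v : 'cV_n => v j ord0) a'0; rewrite !mxE.
rewrite (@lebn_sectionr _ _ [set x : 'cV[R]_(1 + n) | dot a x = c]); last first.
  exact: mset_hyperplane.
apply: integral0_eq => t _; set y := \col_i tnth t i.
rewrite (_ : [set _ | _] = [set (c - dot (dsubmx (a : 'cV[R]_(1 + n))) y) / a ord0 ord0]).
  exact: lebesgue_measure_set1.
apply/seteqP; split=> x /=; rewrite dot_col_mx.
  by move=> <-; rewrite addrK mulrC mulKf.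
by move=> ->; rewrite mulrC divfK// subrK.
Qed.

Lemma lebn_box n (J : set T) : measurable J ->
  mset [set x : 'cV[R]_n | forall i, J (x i ord0)] /\
  lebn [set x : 'cV[R]_n | forall i, J (x i ord0)] =
    (\prod_(i < n) lebesgue_measure J)%E.
Proof.
move=> mJ; elim: n => [|n [mB IHn]].
  split.
    rewrite (_ : [set _ | _] = setT); first exact: measurableT.
    by apply/seteqP; split=> // x _ [].
  rewrite big_ord0 /lebn/= diracE (_ : _ \in _ = true)//.
  by apply/mem_set => -[].
have boxE (x : R) (y : 'cV[R]_n) : (forall i, J ((col_mx x%:M y) i ord0)) <->
    J x /\ forall i, J (y i ord0).
  split=> [H|[Jx Jy] i].
    split; first by have := H (lshift n ord0); rewrite col_mxEu mxE mulr1n.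
    by move=> i; have := H (rshift 1 i); rewrite col_mxEd.
  by case: (@split_ordP 1 n i) => j ->;
    [rewrite col_mxEu ord1 mxE eqxx mulr1n|rewrite col_mxEd].
split.
  rewrite /mset (_ : tset _ = \bigcap_(i in [set: 'I_n.+1]) [set t | J (tnth t i)]).
    apply: fin_bigcap_measurable => // i _.
    by rewrite -[X in measurable X]setTI; exact: measurable_tnth.
  apply/seteqP; split=> t; rewrite /tset/= => H i; first by have := H i; rewrite mxE.
  by rewrite mxE; exact: H.
rewrite big_ord_recl -IHn {1}/lebn/= /lebesgue_step /pushforward.
rewrite -product_measure1E//; congr ((_ \x _)%E _).
apply/seteqP; split=> -[x t]; rewrite /tset/= col_tuple_cons; first by move=> /boxE.
by move=> xt; apply/boxE.
Qed.

Lemma mset_box n M : mset [set x : 'cV[R]_n | forall i, - M <= x i ord0 <= M].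
Proof.
have [+ _] := @lebn_box n `[- M, M]%classic (measurable_itv _).
by congr mset; apply/seteqP; split=> x /= H i; have := H i; rewrite in_itv.
Qed.

Lemma lebn_box_lty n M :
  (lebn [set x : 'cV[R]_n | forall i, (- M <= x i ord0 <= M)%R] < +oo)%E.
Proof.
have [_ /esym H] := @lebn_box n `[- M, M]%classic (measurable_itv _).
rewrite (_ : [set _ | _] = [set x : 'cV[R]_n | forall i,
  `[- M, M]%classic (x i ord0)]); last first.
  by apply/seteqP; split=> x /= K i; have := K i; rewrite in_itv.
rewrite -ge0_fin_numE; last exact: measure_ge0.
rewrite -H; elim/big_ind : _ => [//|x y|i _]; first exact: fin_numM.
by rewrite lebesgue_measure_itv/=; case: ifP.
Qed.

Lemma le_lebn n (X Y : set 'cV[R]_n) : mset X -> mset Y -> X `<=` Y ->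
  (lebn X <= lebn Y)%E.
Proof. by move=> mX mY XY; apply: le_measure; rewrite ?inE// => t; exact: XY. Qed.

Lemma coord_le_enorm n (x : 'cV[R]_n) i : `|x i ord0| <= enorm x.
Proof.
rewrite /enorm -sqrtr_sqr ler_sqrt; last exact: sumsq_ge0.
by rewrite (bigD1 i)//= lerDl sumr_ge0// => j _; exact: sqr_ge0.
Qed.

Lemma enorm_box n (x : 'cV[R]_n) M : enorm x <= M -> forall i, - M <= x i ord0 <= M.
Proof. by move=> xM i; rewrite -ler_norml (le_trans (coord_le_enorm _ _)). Qed.

Lemma lebn_polytope_fin n (P : polytope0 R n) : lebn (polytope_set P) \is a fin_num.
Proof.
have [M M0 PM] := polytope0_bounded P.
rewrite ge0_fin_numE; last exact: measure_ge0.
apply: le_lt_trans (lebn_box_lty n M).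
by apply: le_lebn; [exact: mset_polytope|exact: mset_box|move=> x /PM/enorm_box].
Qed.

Lemma lebn_volume n (P : polytope0 R n) : lebn (polytope_set P) = (volume P)%:E.
Proof. by rewrite volumeE fineK// lebn_polytope_fin. Qed.

Lemma volume_valuation n : is_valuation (fun P : polytope0 R n => volume P).
Proof.
move=> P Q PU PI PUE PIE; apply: EFin_inj; rewrite !EFinD -!lebn_volume PUE PIE.
have mP := mset_polytope P; have mQ := mset_polytope Q.
rewrite /lebn (_ : tset (_ `|` _) = tset (polytope_set P) `|` tset (polytope_set Q))//.
rewrite (_ : tset (_ `&` _) = tset (polytope_set P) `&` tset (polytope_set Q))//.
rewrite measureUfinr//; last by rewrite -ge0_fin_numE ?measure_ge0//; exact: lebn_polytope_fin.
rewrite subeK//.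
have := lebn_polytope_fin PI; rewrite PIE; exact.
Qed.

Lemma volume_SL n : SL_invariant (fun P : polytope0 R n => volume P).
Proof.
move=> A P detA; congr fine.
have uA : A \in unitmx by rewrite unitmxE detA unitr1.
have detV : \det (invmx A) = 1 by rewrite det_inv detA invr1.
rewrite -[RHS](leb_invariant_SL detV (mset_polytope P)).
congr lebn; apply/seteqP; split=> x /= => [[y Py <-]|Px]; first by rewrite mulKmx.
by exists (invmx A *m x) => //; rewrite mulKVmx.
Qed.

Lemma volume_hyperplane n (P : polytope0 R n) a : a != 0 ->
  (forall x, polytope_set P x -> dot a x = 0) -> volume P = 0.
Proof.
move=> a0 Pa; have /le_lebn : polytope_set P `<=` [set x | dot a x = 0] by [].
move=> /(_ (mset_polytope P) (mset_hyperplane _ _)).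
rewrite lebn_hyperplane// lebn_volume lee_fin => V0.
apply/eqP; rewrite eq_le V0 -lee_fin -lebn_volume; exact: measure_ge0.
Qed.

(** The simplex contains a cube of side [1 / (n + 1)], as [n] coordinates of at most this size sum
    to at most 1. *)
Lemma volume_standard_simplex_gt0 n :
  0 < volume (hull0 (fun i : 'I_n => delta_mx i ord0 : 'cV[R]_n)).
Proof.
have [mB lB] := @lebn_box n `[0, n.+1%:R^-1]%classic (measurable_itv _).
rewrite -lte_fin -(lebn_volume (poly_hull0 _)).
have : (0 < \prod_(i < n) lebesgue_measure (`[0%R, (n.+1%:R^-1)%R]%classic : set T))%E.
  elim/big_ind : _ => [|x y|i _]; first by rewrite lte01.
    exact: mule_gt0.
  rewrite lebesgue_measure_itv/= lte_fin invr_gt0 ltr0n/=.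
  by rewrite sube0 lte_fin invr_gt0 ltr0n.
move=> /lt_le_trans; apply.
rewrite -lB; apply: le_lebn => //; first exact: (mset_polytope (poly_hull0 _)).
move=> x /= xB; exists (fun i => x i ord0); split.
- by move=> i; have := xB i; rewrite in_itv/= => /andP[].
- apply: (@le_trans _ _ (\sum_(i < n) n.+1%:R^-1)).
    by apply: ler_sum => i _; have := xB i; rewrite in_itv/= => /andP[].
  rewrite sumr_const card_ord -[X in X <= _]mulr_natl ler_pdivrMr ?ltr0n// mul1r ler_nat.
  exact: leqnSn.
- apply/colP => i; rewrite summxE (bigD1 i)//= big1 ?addr0 => [|j ji].
    by rewrite !mxE !eqxx mulr1.
  by rewrite !mxE eq_sym (negbTE ji) mulr0.
Qed.

End volume_facts.

(** * Continuity of volume in the Hausdorff metric *)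

Section volume_continuity.
Context {R : realType} {n : nat}.
Implicit Types P Q : polytope0 R n.

Lemma hausdorff_dist_lt P Q d : hausdorff_dist P Q < d ->
  exists r, [/\ 0 <= r, r < d, Defs.within r P Q & Defs.within r Q P].
Proof.
rewrite -subr_gt0 => PQd.
have [r [r0 PQ QP] rd] := inf_adherent PQd (hausdorff_radii_has_inf P Q).
by exists r; split=> //; move: rd; rewrite -/(hausdorff_dist P Q) addrC subrK.
Qed.

Lemma lebn_boundary (K : seq ('cV[R]_n * R)) :
  (forall l, l \in K -> l.1 != 0) ->
  mset [set x | exists2 l, l \in K & dot l.1 x + l.2 = 0] /\
  lebn [set x | exists2 l, l \in K & dot l.1 x + l.2 = 0] = 0%E.
Proof.
elim: K => [|k K IHK] K0.
  rewrite (_ : [set _ | _] = set0); last by apply/seteqP; split=> x // -[].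
  by split; [exact: measurable0|exact: measure0].
have [|mK lK] := IHK; first by move=> l lK; apply: K0; rewrite inE lK orbT.
rewrite (_ : [set _ | _] = [set x | dot k.1 x = - k.2] `|`
    [set x | exists2 l, l \in K & dot l.1 x + l.2 = 0]).
  split; first by apply: msetU => //; exact: mset_hyperplane.
  apply: null_set_setU => //; first exact: mset_hyperplane.
  by apply: lebn_hyperplane; apply: K0; rewrite mem_head.
apply/seteqP; split=> x /=.
  move=> [l]; rewrite inE => /orP[/eqP ->|lK'] lx; last by right; exists l.
  by left; apply/eqP; rewrite -addr_eq0 lx.
move=> [kx|[l lK' lx]]; last by exists l; rewrite ?inE ?lK' ?orbT.
by exists k; rewrite ?mem_head// kx addNr.
Qed.

Lemma enorm_eq0 (x : 'cV[R]_n) : (enorm x == 0) = (x == 0).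
Proof.
by apply/eqP/eqP => [/enorm0_eq0//|->]; rewrite enorm0.
Qed.

(* A point outside [Q] is strictly separated from [Q]; moving it by [r] against
   the normal of the separating hyperplane keeps it at distance at least [r]. *)
Lemma escape_polytope Q (x : 'cV[R]_n) r : 0 <= r -> ~ polytope_set Q x ->
  exists2 u, enorm u <= r &
    forall y, polytope_set Q y -> r <= enorm (x + u - y).
Proof.
move=> r0 Qx; have [K QK] := halfspace_rep Q.
have [l lK lx] : exists2 l, l \in K & dot l.1 x + l.2 < 0.
  apply: contrapT => H; apply: Qx; apply/QK => l lK; rewrite leNgt.
  by apply/negP => lx; apply: H; exists l.
have l1 : 0 < enorm l.1.
  rewrite lt_neqAle eq_sym enorm_eq0 enorm_ge0 andbT; apply/eqP => l0.
  have /QK/(_ _ lK) := polytope_origin Q; move: lx.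
  by rewrite l0 !dot0l add0r => /lt_le_trans /[apply]; rewrite ltxx.
have ll : dot l.1 l.1 = enorm l.1 ^+ 2.
  by rewrite enorm_sqr; apply: eq_bigr => i _; rewrite expr2.
exists (- (r / enorm l.1) *: l.1).
  by rewrite enormZ normrN ger0_norm ?divr_ge0 ?enorm_ge0// divfK// gt_eqF.
move=> y /QK/(_ _ lK) ly.
rewrite -(ler_pM2l l1) -[X in _ <= X * _]enormN; apply: le_trans (dot_le_enorm _ _).
rewrite dotNl dotBr dotDr dotZr ll mulNr.
have -> : r / enorm l.1 * enorm l.1 ^+ 2 = enorm l.1 * r.
  by field; rewrite gt_eqF.
lra.
Qed.

Lemma archimedean_seq (A : eqType) (s : seq A) (f g : A -> R) :
  (forall a, 0 <= g a) -> (forall a, a \in s -> 0 < f a) ->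
  exists k, forall a, a \in s -> g a * k.+1%:R^-1 <= f a.
Proof.
move=> g0; elim: s => [|a s IHs] f0; first by exists 0%N.
have [|k Hk] := IHs; first by move=> b bs; apply: f0; rewrite inE bs orbT.
have fa : 0 < f a by apply: f0; rewrite mem_head.
have := archi_boundP (divr_ge0 (g0 a) (ltW fa)); set m := Num.bound _ => gm.
exists (maxn k m) => b; rewrite inE => /orP[/eqP ->|/Hk].
  rewrite ler_pdivrMr// mulrC -ler_pdivrMr//; apply: le_trans (ltW gm) _.
  by rewrite ler_nat ltnW// ltnS leq_maxr.
apply: le_trans; apply: ler_wpM2l => //.
by rewrite lef_pV2 ?posrE ?ltr0n// ler_nat ltnS leq_maxl.
Qed.

(** The shrunken sets [I k] increase to [P] up to its null boundary, and every polytope closer to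
    [P] than [1 / (k + 1)] contains [I k]. *)
Lemma volume_lsc P e : 0 < e ->
  exists2 d, 0 < d & forall Q, hausdorff_dist P Q < d -> volume P - e < volume Q.
Proof.
move=> e0; have [K PK] := halfspace_rep P.
have K0 l : l \in K -> 0 <= l.2.
  by move=> lK; have /PK/(_ _ lK) := polytope_origin P; rewrite dot0r add0r.
(* Forms with zero linear part hold everywhere; without them each equality set is a hyperplane,
   hence null. *)
pose K' := [seq l <- K | l.1 != 0].
pose I k := [set x : 'cV[R]_n | forall l, l \in K' ->
  enorm l.1 * k.+1%:R^-1 <= dot l.1 x + l.2].
have mI k : mset (I k) by exact: mset_halfspaces.
have mUI : measurable (\bigcup_k tset (I k)) by apply: bigcupT_measurable => k; exact: mI.
have [|mB lB] := @lebn_boundary K'; first by move=> l; rewrite mem_filter => /andP[].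
have VP : ((volume P - e)%:E < lebn (polytope_set P))%E.
  by rewrite lebn_volume lte_fin ltrBlDr ltrDl.
have PU : (lebn (polytope_set P) <= lebesgue_tuple n (\bigcup_k tset (I k)))%E.
  rewrite -(measureU0 mUI mB lB); apply: le_measure; rewrite ?inE.
  - exact: mset_polytope.
  - exact: measurableU.
  - move=> t; rewrite /tset/= => Px.
    have [|noB] := pselect (exists2 l, l \in K' & dot l.1 (\col_i tnth t i) + l.2 = 0).
      by right.
    left; have [|k Hk] := @archimedean_seq _ K' (fun l => dot l.1 (\col_i tnth t i) + l.2)
        (fun l => enorm l.1) (fun l => enorm_ge0 _).
      move=> l lK'; rewrite lt_neqAle; apply/andP; split.
        by apply/eqP => l0; apply: noB; exists l.
      by move/PK : Px; apply; move: lK'; rewrite mem_filter => /andP[].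
    by exists k.
have cvgI : (lebesgue_tuple n \o (fun k => tset (I k))) @ \oo -->
    lebesgue_tuple n (\bigcup_k tset (I k)).
  apply: nondecreasing_cvg_mu => // k m km; apply/subsetPset => t H l /H.
  apply: le_trans; apply: ler_wpM2l; first exact: enorm_ge0.
  by rewrite lef_pV2 ?posrE ?ltr0n// ler_nat.
have [k _ /(_ k (leqnn k)) Ik] := cvgI _ (open_ereal_gt' (lt_le_trans VP PU)).
exists k.+1%:R^-1; first by rewrite invr_gt0.
move=> Q /hausdorff_dist_lt[r [r0 rk PQ QP]].
rewrite -lte_fin -[X in (_ < X)%E]lebn_volume; apply: lt_le_trans Ik _.
apply: le_lebn => //; first exact: mset_polytope.
move=> x Ix; apply: contrapT => Qx.
(* A point of [I k] outside [Q] could be moved within [P] to distance at least [1 / (k + 1)] from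
   [Q], but [P] lies within [r < 1 / (k + 1)] of [Q]. *)
have [|u uk uQ] := @escape_polytope Q x k.+1%:R^-1 _ Qx; first by rewrite invr_ge0.
have /PQ[y Qy xuy] : polytope_set P (x + u).
  apply/PK => l lK; have [->|l0] := eqVneq l.1 0; first by rewrite dot0l add0r K0.
  have := Ix l; rewrite mem_filter l0 => /(_ lK) lx.
  have := dot_norm_le l.1 u; rewrite dotDr ler_norml => /andP[+ _].
  have : enorm l.1 * enorm u <= enorm l.1 * k.+1%:R^-1.
    by apply: ler_wpM2l => //; exact: enorm_ge0.
  by move: (enorm l.1 * k.+1%:R^-1) lx (enorm l.1 * enorm u) => X lx Y; lra.
by have := lt_le_trans rk (uQ _ Qy); rewrite ltNge xuy.
Qed.

(** The relaxed sets [O k] decrease to [P] and contain every polytope closer than [1 / (k + 1)]. The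
    box gives them finite measure, as continuity from above requires; its margin 1 suffices because
    [1 / (k + 1) <= 1]. *)
Lemma volume_usc P e : 0 < e ->
  exists2 d, 0 < d & forall Q, hausdorff_dist P Q < d -> volume Q < volume P + e.
Proof.
move=> e0; have [K PK] := halfspace_rep P.
have [M M0 PM] := polytope0_bounded P.
pose O k := [set x : 'cV[R]_n | forall l, l \in K ->
  - (enorm l.1 * k.+1%:R^-1) <= dot l.1 x + l.2] `&`
  [set x | forall i, - (M + 1) <= x i ord0 <= M + 1].
have mO k : mset (O k).
  by apply: msetI; [exact: mset_halfspaces|exact: mset_box].
have mcap : measurable (\bigcap_k tset (O k)).
  by apply: bigcapT_measurable => k; exact: mO.
have capP : \bigcap_k tset (O k) = tset (polytope_set P).
  apply/seteqP; split=> t; rewrite /tset/=; last first.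
    move=> Px k _; split; last by apply: enorm_box; rewrite (le_trans (PM _ Px))// lerDl.
    move=> l lK; move/PK : Px => /(_ _ lK); apply: le_trans.
    by rewrite oppr_le0 mulr_ge0 ?enorm_ge0// invr_ge0.
  move=> H; apply/PK => l lK; rewrite leNgt; apply/negP => lx.
  have [|k] := @archimedean_seq _ [:: l] (fun l => - (dot l.1 (\col_i tnth t i) + l.2) / 2)
    (fun l => enorm l.1) (fun l => enorm_ge0 _).
    by move=> m; rewrite inE => /eqP ->; lra.
  move=> /(_ _ (mem_head _ _)); have [/(_ _ lK)] := H k I.
  by set X := enorm _ * _; lra.
have cvgO : (lebesgue_tuple n \o (fun k => tset (O k))) @ \oo --> lebn (polytope_set P).
  rewrite /lebn -capP; apply: nonincreasing_cvg_mu => //.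
  - apply: le_lt_trans (lebn_box_lty n (M + 1)).
    by apply: le_lebn; [exact: mO|exact: mset_box|move=> x []].
  - move=> k m km; apply/subsetPset => t [H Hb]; split=> // l /H; apply: le_trans.
    rewrite lerN2; apply: ler_wpM2l; first exact: enorm_ge0.
    by rewrite lef_pV2 ?posrE ?ltr0n// ler_nat.
have VP : (lebn (polytope_set P) < (volume P + e)%:E)%E.
  by rewrite lebn_volume lte_fin ltrDl.
have [k _ /(_ k (leqnn k)) Ok] := cvgO _ (open_ereal_lt' VP).
exists k.+1%:R^-1; first by rewrite invr_gt0.
move=> Q /hausdorff_dist_lt[r [r0 rk PQ QP]].
rewrite -lte_fin -lebn_volume; apply: le_lt_trans Ok.
apply: le_lebn => //; first exact: mset_polytope.
move=> x Qx; have [y Py xy] := QP _ Qx; split.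
  move=> l lK; have /PK/(_ _ lK) ly := Py.
  have := dot_norm_le l.1 (x - y); rewrite dotBr ler_norml => /andP[+ _].
  have : enorm l.1 * enorm (x - y) <= enorm l.1 * k.+1%:R^-1.
    by apply: ler_wpM2l; [exact: enorm_ge0|exact: le_trans xy (ltW rk)].
  by move: (enorm l.1 * k.+1%:R^-1) (enorm l.1 * enorm (x - y)) => X Y; lra.
apply: enorm_box; rewrite -[x](subrK y) addrC.
apply: le_trans (enormD _ _) _; apply: lerD; first exact: PM.
apply: le_trans xy (le_trans (ltW rk) _).
by rewrite invf_le1 ?ltr0n// ler1n.
Qed.

End volume_continuity.

(** * Values on simplices *)

Section hull_limits.
Context {R : realType} {n : nat}.
Local Notation V := 'cV[R]_n.
Implicit Types P Q : polytope0 R n.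

(** The same weights on both families move a point by at most the largest displacement of a
    generator. *)
Lemma within_hull0 (I : finType) (u v : I -> V) r : 0 <= r ->
  (forall i, enorm (u i - v i) <= r) -> Defs.within r (hull0 u) (hull0 v).
Proof.
move=> r0 uv x [w [w0 w1 ->]]; exists (\sum_i w i *: v i); first by exists w.
rewrite -sumrB; apply: (@le_trans _ _ (\sum_i w i * r)).
  elim/big_ind2 : _ => [|a b c d ab cd|i _]; first by rewrite enorm0.
    by apply: le_trans (enormD _ _) _; exact: lerD.
  by rewrite -scalerBr enormZ ger0_norm//; exact: ler_wpM2l.
by rewrite -mulr_suml ler_piMl.
Qed.

Lemma hausdorff_hull0 (I : finType) (u v : I -> V) r : 0 <= r ->
  (forall i, enorm (u i - v i) <= r) ->
  hausdorff_dist (poly_hull0 u) (poly_hull0 v) <= r.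
Proof.
move=> r0 uv; apply: ge_inf; first exact: (hausdorff_radii_has_inf _ _).2.
split; [exact: r0|exact: within_hull0|apply: within_hull0 => // i].
by rewrite -enormN opprB; exact: uv.
Qed.

Lemma near_polytope0P P (A : polytope0 R n -> Prop) :
  (\forall Q \near P, A Q) <->
  exists2 d, 0 < d & forall Q, hausdorff_dist P Q < d -> A Q.
Proof.
split=> [/nbhs_ballP[d /= d0 PA]|[d d0 PA]].
  by exists d => // Q PQ; apply: PA; rewrite ballEmdist.
by apply/nbhs_ballP; exists d => //= Q; rewrite ballEmdist => /PA.
Qed.

Lemma usc_hull0 (Psi : polytope0 R n -> R) (I : finType) (v : I -> V) e :
  upper_semicontinuous Psi -> 0 < e ->
  exists2 d, 0 < d & forall u : I -> V, (forall i, enorm (u i - v i) < d) ->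
    Psi (poly_hull0 u) < Psi (poly_hull0 v) + e.
Proof.
move=> usc e0; have [|d d0 H] := (near_polytope0P _ _).1
  (usc (poly_hull0 v) (Psi (poly_hull0 v) + e) _); first by rewrite ltrDl.
exists (d / 2) => [|u uv]; first by rewrite divr_gt0.
apply: H; rewrite hausdorff_dist_sym; apply: (@le_lt_trans _ _ (d / 2)); last by lra.
by apply: hausdorff_hull0 => [|i]; [rewrite divr_ge0// ltW|exact/ltW].
Qed.

Lemma poly_hull0_mulmx (I : finType) (A : 'M[R]_n) (v : I -> V) :
  polytope_mulmx A (poly_hull0 v) = poly_hull0 (fun i => A *m v i).
Proof.
apply: polytope0_inj; apply/seteqP; split=> x /=.
  move=> [_ [w [w0 w1 ->]] <-]; exists w; split=> //.
  by rewrite mulmx_sumr; apply: eq_bigr => i _; rewrite scalemxAr.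
move=> [w [w0 w1 ->]]; exists (\sum_i w i *: v i); first by exists w.
by rewrite mulmx_sumr; apply: eq_bigr => i _; rewrite scalemxAr.
Qed.

Lemma poly_hull0_eq0 (I J : finType) (v : I -> V) (u : J -> V) :
  (forall i, v i = 0 \/ exists j, v i = u j) ->
  (forall j, u j = 0 \/ exists i, u j = v i) -> poly_hull0 v = poly_hull0 u.
Proof. by move=> vu uv; apply: polytope0_inj; exact: hull0_eq0. Qed.

Definition simplex_mx j (U : 'M[R]_(n, j)) : polytope0 R n :=
  poly_hull0 (fun k => col k U).

Lemma simplex_mxM j (A : 'M[R]_n) (U : 'M[R]_(n, j)) :
  simplex_mx (A *m U) = polytope_mulmx A (simplex_mx U).
Proof.
rewrite poly_hull0_mulmx; apply: polytope0_inj => /=; congr hull0.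
by apply/funext => k; rewrite !colE mulmxA.
Qed.

End hull_limits.

(** * Matrices with independent columns, and determinants *)

Section determinants.
Context {R : realType}.

Definition left_invertible n j (U : 'M[R]_(n, j)) := exists G, G *m U = 1%:M.

Lemma left_invertibleM n j k (U : 'M[R]_(n, j)) (E : 'M[R]_(j, k)) :
  left_invertible U -> left_invertible E -> left_invertible (U *m E).
Proof.
move=> [G GU] [F FE]; exists (F *m G).
by rewrite mulmxA -(mulmxA F) GU mulmx1.
Qed.

Lemma left_invertible_unit n (U : 'M[R]_n) : U \in unitmx -> left_invertible U.
Proof. by move=> uU; exists (invmx U); exact: mulVmx. Qed.

Lemma left_invertible_leq n j (U : 'M[R]_(n, j)) : left_invertible U -> (j <= n)%N.
Proof.
move=> [G GU]; have := mulmx_max_rank G U; rewrite GU mxrank1; exact.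
Qed.

Lemma left_invertible_col' n j (U : 'M[R]_(n, j.+1)) k :
  left_invertible U -> left_invertible (col' k U).
Proof.
move=> [G GU]; exists (row' k G); apply/matrixP => a b.
rewrite [RHS]mxE -(inj_eq (@lift_inj _ k)).
have /matrixP/(_ (lift k a) (lift k b)) := GU; rewrite [RHS]mxE => <-.
by rewrite !mxE; apply: eq_bigr => i _; rewrite !mxE.
Qed.

(** Right multiplication by this matrix moves one vertex of a simplex: column [q] becomes the
    combination of columns with coefficients [c]. *)
Definition col_repl n (q : 'I_n) (c : 'cV[R]_n) : 'M[R]_n :=
  \matrix_(i, k) if k == q then c i ord0 else (i == k)%:R.

Lemma col_mul_repl n j (U : 'M[R]_(n, j)) q c k :
  col k (U *m col_repl q c) = if k == q then U *m c else col k U.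
Proof.
apply/colP => i; rewrite !mxE; case: (eqVneq k q) => [->|kq].
  by rewrite mxE; apply: eq_bigr => a _; rewrite !mxE eqxx.
rewrite mxE (bigD1 k)//= big1 ?addr0 => [|a ak].
  by rewrite !mxE (negbTE kq) eqxx mulr1.
by rewrite !mxE (negbTE kq) (negbTE ak) mulr0.
Qed.

(** The expansion along column [q] involves only cofactors of the identity. *)
Lemma det_col_repl n (q : 'I_n) c : \det (col_repl q c) = c q ord0.
Proof.
rewrite (expand_det_col _ q) -[in RHS](mul1mx c) -adj1 [RHS]mxE.
apply: eq_bigr => i _; rewrite !mxE eqxx mulrC; congr (_ * _).
rewrite /cofactor; congr (_ * \det _); apply/matrixP => a b; rewrite !mxE.
by rewrite eq_sym (negbTE (neq_lift _ _)).
Qed.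

(** Completing the columns to a basis gives an invertible matrix. The shape [j + m.+1] leaves at
    least one coordinate that [pid_mx j] does not see, and scaling it corrects the determinant. *)
Lemma SL_extension j m (U : 'M[R]_(j + m.+1, j)) : left_invertible U ->
  exists2 A : 'M[R]_(j + m.+1), \det A = 1 & U = A *m pid_mx j.
Proof.
move=> [G GU].
have rU : \rank U = j.
  apply/eqP; rewrite eqn_leq rank_leq_col/=.
  by have := mxrankM_maxr G U; rewrite GU mxrank1.
pose A0 : 'M[R]_(j + m.+1) := col_ebase U *m block_mx (row_ebase U) 0 0 1%:M.
have uA0 : A0 \in unitmx.
  rewrite unitmx_mul col_ebase_unit/= unitmxE det_ublock det1 mulr1 -unitmxE.
  exact: row_ebase_unit.
have UE : U = A0 *m pid_mx j.
  rewrite -[LHS]mulmx_ebase rU /A0 -!mulmxA; congr (_ *m _).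
  by rewrite (@pid_mx_col R m.+1 j) mul_block_col mul_col_mx !mul1mx !mulmx1 !mulmx0 !mul0mx !addr0.
pose d := \det A0.
have d0 : d != 0 by rewrite -unitfE -unitmxE.
pose D : 'M[R]_m.+1 := diag_mx (\row_i if i == ord0 then d^-1 else 1).
have detD : \det D = d^-1.
  rewrite det_diag big_ord_recl big1 ?mxE ?mulr1// => i _.
  by rewrite mxE.
exists (A0 *m block_mx 1%:M 0 0 D).
  by rewrite det_mulmx det_ublock det1 mul1r detD mulfV.
rewrite {1}UE pid_mx_col -mulmxA; congr (_ *m _).
by rewrite mul_block_col !mul1mx !mulmx0 !addr0 mul0mx.
Qed.

End determinants.

(** * Cauchy's functional equation on the positive reals *)

Section cauchy_equation.
Context {R : realType}.

(** The additive remainder [h] vanishes at positive rationals, so all its values occur near 0 and it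
    is bounded above. Taking multiples of the argument forces [h <= 0], and [h a = - h (k - a)] for
    an integer [k > a] gives equality. *)
Lemma cauchy_usc (g : R -> R) :
  (forall a b, 0 < a -> 0 < b -> g (a + b) = g a + g b) ->
  (exists2 d, 0 < d & forall a, 0 < a -> a < d -> g a < 1) ->
  forall a, 0 < a -> g a = g 1 * a.
Proof.
move=> gD [d d0 gd].
pose h a := g a - g 1 * a.
have hD a b : 0 < a -> 0 < b -> h (a + b) = h a + h b.
  by move=> a0 b0; rewrite /h gD//; ring.
have hM m a : 0 < a -> h (m.+1%:R * a) = m.+1%:R * h a.
  move=> a0; elim: m => [|m IHm]; first by rewrite !mul1r.
  rewrite -natr1 !mulrDl !mul1r hD ?IHm//.
  by rewrite mulr_gt0// ltr0n.
have h1 : h 1 = 0 by rewrite /h mulr1 subrr.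
have hV m : h (m.+1%:R^-1) = 0.
  have := hM m m.+1%:R^-1; rewrite mulfV ?pnatr_eq0// h1 => /(_ _)/esym/eqP.
  rewrite mulf_eq0 pnatr_eq0/= => H; apply/eqP; apply: H.
  by rewrite invr_gt0 ltr0n.
have hQ k m : h (k.+1%:R * m.+1%:R^-1) = 0.
  by rewrite hM ?hV ?mulr0// invr_gt0 ltr0n.
have [m md] : exists m, m.+1%:R^-1 < d :> R.
  have := archi_boundP (ltW (_ : 0 < d^-1)); rewrite invr_gt0 => /(_ d0) dm.
  exists (Num.bound d^-1); rewrite invf_plt ?posrE ?ltr0n//.
  by apply: lt_trans dm _; rewrite ltr_nat.
pose s : R := m.+1%:R^-1.
have s0 : 0 < s by rewrite invr_gt0 ltr0n.
(* Every positive number differs from some [x < d] by a multiple of [s]. *)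
have red a : 0 < a -> exists x, [/\ 0 < x, x < d & h a = h x].
  move=> a0; have [k [x [x0 xs aE]]] : exists k x, [/\ 0 < x, x <= s & a = k%:R * s + x].
    have exk : exists k, a <= k.+1%:R * s.
      have := archi_boundP (ltW (divr_gt0 a0 s0)); rewrite ltr_pdivrMr// => /ltW ak.
      exists (Num.bound (a / s)); apply: le_trans ak _.
      by rewrite ler_pM2r// ler_nat.
    exists (ex_minn exk), (a - (ex_minn exk)%:R * s).
    case: ex_minnP => k ak kmin; split; last by rewrite addrC subrK.
      rewrite subr_gt0; case: k ak kmin => [|k] _ kmin; first by rewrite mul0r.
      by rewrite ltNge; apply/negP => /kmin; rewrite ltnn.
    by move: ak; rewrite lerBlDl -natr1 mulrDl mul1r.
  exists x; split=> //; first exact: le_lt_trans md.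
  case: k aE => [|k] ->; first by rewrite mul0r add0r.
  rewrite hD ?hQ ?add0r// mulr_gt0// ltr0n.
pose M := 1 + `|g 1| * d.
have hM1 a : 0 < a -> h a < M.
  move=> /red[x [x0 xd ->]]; rewrite /h /M.
  have : - (g 1 * x) <= `|g 1| * d.
    apply: le_trans (ler_norm _) _; rewrite normrN normrM (gtr0_norm x0).
    by rewrite ler_wpM2l// ltW.
  by have := gd _ x0 xd; lra.
have hle a : 0 < a -> h a <= 0.
  move=> a0; rewrite leNgt; apply/negP => ha0.
  have := archi_boundP (ltW (divr_gt0 (le_lt_trans (ltW ha0) (hM1 _ a0)) ha0)).
  set k := Num.bound _ => kM.
  have := hM1 (k.+1%:R * a) (mulr_gt0 _ a0); rewrite ltr0n hM// => /(_ isT).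
  rewrite ltNge => /negP; apply; rewrite -ler_pdivrMr//.
  by apply: le_trans (ltW kM) _; rewrite ler_nat.
move=> a a0; apply/eqP; rewrite -subr_eq0 -/(h a) eq_le hle//=.
have [k ak] : exists k, a < k.+1%:R.
  have := archi_boundP (ltW a0) => /lt_trans ak.
  by exists (Num.bound a); apply: ak; rewrite ltr_nat.
have ka : 0 < k.+1%:R - a by rewrite subr_gt0.
have hk : h k.+1%:R = 0 by have := hM k 1 ltr01; rewrite mulr1 h1 mulr0.
have := hD a _ a0 ka; rewrite addrC subrK hk => E.
by have := hle _ ka; lra.
Qed.

End cauchy_equation.

(** * Values of an SL(n) invariant, upper semicontinuous valuation on simplices *)

Section simplex_values.
Context {R : realType} {n' : nat}.
Local Notation n := n'.+2.
Local Notation V := 'cV[R]_n.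
Variable Psi : polytope0 R n -> R.
Hypothesis usc : upper_semicontinuous Psi.
Hypothesis SL : SL_invariant Psi.
Hypothesis Psi_val : is_valuation Psi.

(** Values at representatives of the SL(n) orbits: [tau j] for simplices of dimension [j] below [n],
    [G a] for full simplices of determinant [a]. *)
Let tau j := Psi (simplex_mx (pid_mx j : 'M[R]_(n, j))).
Let dg (a : R) : 'M[R]_n := diag_mx (\row_i if i == ord0 then a else 1).
Let G a := Psi (simplex_mx (dg a)).

Lemma det_dg a : \det (dg a) = a.
Proof.
rewrite det_diag big_ord_recl big1 ?mulr1 => [|i _]; first by rewrite mxE.
by rewrite mxE.
Qed.

Lemma dg_unit a : a != 0 -> dg a \in unitmx.
Proof. by rewrite unitmxE det_dg unitfE. Qed.

Lemma Psi_lower j (U : 'M[R]_(n, j)) : (j < n)%N -> left_invertible U ->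
  Psi (simplex_mx U) = tau j.
Proof.
move=> jn; rewrite /tau; have [m nE] : exists m, n = (j + m.+1)%N.
  by exists (n - j.+1)%N; rewrite addnS -addSn subnKC.
(* Rewriting [n] changes types, so [Psi] and [U] are generalised first. *)
move: Psi SL U; rewrite nE => F FSL U iU.
by have [A detA ->] := SL_extension iU; rewrite simplex_mxM FSL.
Qed.

(** [U] differs from [dg (\det U)] by a left factor of determinant 1. *)
Lemma Psi_full (U : 'M[R]_n) : U \in unitmx -> Psi (simplex_mx U) = G (\det U).
Proof.
rewrite unitmxE unitfE => d0.
have uD := dg_unit d0.
rewrite /G -[U in LHS](mulmxKV uD) simplex_mxM SL//.
by rewrite det_mulmx det_inv det_dg mulfV.
Qed.

(** Swapping two columns changes the sign of the determinant but not the simplex. *)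
Lemma G_norm d : d != 0 -> G `|d| = G d.
Proof.
move=> d0; suff GN a : a != 0 -> G (- a) = G a.
  by case: (ger0P d) => // _; rewrite GN.
move=> a0; pose s := @tperm 'I_n ord0 (lift ord0 ord0).
have dU : \det (dg a *m perm_mx s) = - a.
  by rewrite det_mulmx det_dg det_perm odd_tperm/= expr1 mulrN1.
rewrite -dU -Psi_full; last by rewrite unitmxE dU unitfE oppr_eq0.
rewrite -[in RHS](det_dg a) -Psi_full ?dg_unit//; congr Psi.
have colE k : col k (dg a *m perm_mx s) = col (s k) (dg a).
  by rewrite -xcolE; apply/colP => i; rewrite !mxE.
apply: poly_hull0_eq0 => k; right.
  by exists (s k); rewrite colE.
by exists (s k); rewrite colE tpermK.
Qed.

Let mid j t : 'cV[R]_j.+2 := (1 - t) *: delta_mx ord0 ord0 + t *: delta_mx (lift ord0 ord0) ord0.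

Lemma Psi_cut_edge j (U : 'M[R]_(n, j.+2)) t : left_invertible U -> 0 < t < 1 ->
  Psi (simplex_mx (U *m col_repl (lift ord0 ord0) (mid j t))) +
  Psi (simplex_mx (U *m col_repl ord0 (mid j t))) =
  Psi (simplex_mx U) +
  Psi (simplex_mx (col' ord0 (U *m col_repl (lift ord0 ord0) (mid j t)))).
Proof.
move=> [F FU] /andP[t0 t1].
pose p : 'I_j.+2 := ord0; pose q : 'I_j.+2 := lift ord0 ord0.
have FUE i k : dot (row i F)^T (col k U) = (i == k)%:R.
  have /matrixP/(_ i k) := FU; rewrite !mxE => <-.
  by apply: eq_bigr => a _; rewrite !mxE.
(* This form is [t] and [- (1 - t)] at columns [p] and [q] and 0 at the others, so it vanishes on
   their edge exactly at [U *m mid j t]. *)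
pose h : V := t *: (row p F)^T - (1 - t) *: (row q F)^T.
have hE k : dot h (col k U) = t * (p == k)%:R - (1 - t) * (q == k)%:R.
  by rewrite dotBl !dotZl !FUE.
have t1' : 0 < 1 - t by rewrite subr_gt0.
have := @hull0_cut_edge _ _ _ (fun k => col k U) h p q t (1 - t) t0 t1'.
rewrite !hE !eqxx /= mulr1 mulr0 subr0 mulr0 mulr1 sub0r.
have -> : t + (1 - t) = 1 by rewrite addrC subrK.
move=> /(_ erefl erefl); rewrite !divr1.
have <- : U *m mid j t = (1 - t) *: col p U + t *: col q U.
  by rewrite mulmxDr -!scalemxAr -!colE.
case=> [i ip iq|c1 c2 c0]; first by rewrite hE eq_sym (negbTE ip) eq_sym (negbTE iq) !mulr0 subrr.
have col1 k : (if k == q then U *m mid j t else col k U) =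
  col k (U *m col_repl q (mid j t)) by rewrite col_mul_repl.
have col0 k : (if k == p then U *m mid j t else col k U) =
  col k (U *m col_repl p (mid j t)) by rewrite col_mul_repl.
apply: (valuation_cut (h := h) Psi_val) => x.
- rewrite -[polytope_set (simplex_mx U) x /\ _]/((_ `&` [set x | 0 <= dot h x]) x) c1.
  by rewrite /=; under [in X in _ <-> X]eq_fun do rewrite col1.
- rewrite -[polytope_set (simplex_mx U) x /\ _]/((_ `&` [set x | dot h x <= 0]) x) c2.
  by rewrite /=; under [in X in _ <-> X]eq_fun do rewrite col0.
- rewrite -[polytope_set (simplex_mx U) x /\ _]/((_ `&` [set x | dot h x = 0]) x) c0.
  rewrite /= (@hull0_eq0 _ _ _ _ _ (fun k => if k == p then 0
    else if k == q then U *m mid j t else col k U))// => k.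
    right; exists (lift ord0 k); rewrite eq_sym (negbTE (neq_lift _ _)) col1.
    by apply/colP => i; rewrite !mxE.
  case: (eqVneq k p) => [_|kp]; first by left.
  right; case: (unliftP ord0 k) => [i ki|k0]; last by rewrite k0 eqxx in kp.
  by exists i; rewrite col1 ki; apply/colP => a; rewrite !mxE.
Qed.

Lemma mid0 j t : mid j t ord0 ord0 = 1 - t.
Proof. by rewrite !mxE eqxx/= mulr1 mulr0 addr0. Qed.

Lemma mid1 j t : mid j t (lift ord0 ord0) ord0 = t.
Proof. by rewrite !mxE eqxx/= mulr1 mulr0 add0r. Qed.

Lemma col_repl_unit j q t : mid j t q ord0 != 0 -> col_repl q (mid j t) \in unitmx.
Proof. by rewrite unitmxE det_col_repl unitfE. Qed.

(** Bisecting an edge gives [tau j.+2 + tau j.+2 = tau j.+2 + tau j.+1]. *)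
Lemma tau_const j : (0 < j < n)%N -> tau j = tau 1.
Proof.
elim: j => // -[//|j] IHj /andP[_ jn]; rewrite -IHj ?(ltn_trans _ jn)//.
have iU : left_invertible (pid_mx j.+2 : 'M[R]_(n, j.+2)).
  by exists (pid_mx j.+2); rewrite pid_mx_id ?(ltnW jn)// pid_mx_1.
pose hf : R := 2^-1.
have hf0 : 0 < hf by rewrite invr_gt0 ltr0n.
have hf1 : hf < 1 by rewrite invf_lt1 ?ltr0n// ltr1n.
have h01 : 0 < hf < 1 by rewrite hf0 hf1.
have h0 : 1 - hf != 0 by rewrite subr_eq0 gt_eqF.
have iM q : mid j hf q ord0 != 0 ->
    left_invertible ((pid_mx j.+2 : 'M[R]_(n, j.+2)) *m col_repl q (mid j hf)).
  move=> mq; apply: left_invertibleM => //.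
  by apply: left_invertible_unit; exact: col_repl_unit.
have i1 := iM (lift ord0 ord0); have i0 := iM ord0; move: i1 i0.
rewrite mid0 mid1 gt_eqF// => /(_ isT) i1 /(_ h0) i0.
have := Psi_cut_edge iU h01; rewrite !Psi_lower//.
- by move/addrI.
- exact: ltn_trans jn.
- exact: left_invertible_col'.
Qed.

(** An edge of a simplex of determinant [a + b] is divided so that the pieces have determinants [a]
    and [b]; their common facet has the value [tau 1]. *)
Lemma G_additive a b : 0 < a -> 0 < b -> G (a + b) + tau 1 = G a + G b.
Proof.
move=> a0 b0; have ab0 : 0 < a + b by rewrite addr_gt0.
have abn0 : a + b != 0 by rewrite gt_eqF.
pose t := a / (a + b).
have t01 : 0 < t < 1 by rewrite divr_gt0//= ltr_pdivrMr// mul1r ltrDl.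
have iU := left_invertible_unit (dg_unit abn0).
have t1E : 1 - t = b / (a + b) by rewrite /t; field.
have t1 : mid n' t (lift ord0 ord0) ord0 != 0.
  by rewrite mid1; case/andP: t01 => /gt_eqF ->.
have t0 : mid n' t ord0 ord0 != 0.
  by rewrite mid0 t1E mulf_neq0 ?invr_eq0// gt_eqF.
have := Psi_cut_edge iU t01.
rewrite (@Psi_lower n'.+1)//; last first.
  apply: left_invertible_col'; apply: left_invertibleM => //.
  by apply: left_invertible_unit; exact: col_repl_unit.
rewrite !Psi_full ?unitmx_mul ?dg_unit ?col_repl_unit// !det_mulmx !det_col_repl.
rewrite mid0 mid1 det_dg t1E tau_const ?ltnS ?leqnn//.
by rewrite /t !(mulrC (a + b)) !divfK// => ->.
Qed.

Lemma enorm_delta i : enorm (delta_mx i ord0 : V) = 1.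
Proof.
rewrite /enorm (bigD1 i)//= big1 => [|j ji].
  by rewrite mxE !eqxx expr1n addr0 sqrtr1.
by rewrite mxE (negbTE ji) expr0n.
Qed.

(** As [a] tends to 0, the simplex of [dg a] collapses to the facet generated by the columns of
    [dg 0], where [Psi] is [tau 1]. *)
Lemma G_near0 e : 0 < e -> exists2 d, 0 < d & forall a, 0 < a -> a < d -> G a < tau 1 + e.
Proof.
move=> e0.
have [d d0 H] := usc_hull0 (fun k => col k (dg 0)) usc e0.
exists d => // a a0 ad; rewrite -(@tau_const n'.+1) ?ltnS ?leqnn//.
rewrite -(@Psi_lower _ (col' ord0 (1%:M : 'M[R]_n)))//; last first.
  by apply: left_invertible_col'; apply: left_invertible_unit; exact: unitmx1.
have -> : simplex_mx (col' ord0 (1%:M : 'M[R]_n)) = poly_hull0 (fun k => col k (dg 0)).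
  have dgE k : col (lift ord0 k) (dg 0) = col k (col' ord0 (1%:M : 'M[R]_n)).
    apply/colP => i; rewrite !mxE; case: (eqVneq i (lift ord0 k)) => [->|_]; last by [].
    by rewrite eq_sym (negbTE (neq_lift _ _)).
  apply: poly_hull0_eq0 => k; first by right; exists (lift ord0 k); rewrite dgE.
  case: (unliftP ord0 k) => [i ->|->]; first by right; exists i; rewrite dgE.
  by left; apply/colP => i; rewrite !mxE; case: (eqVneq i ord0) => _; rewrite ?mul0rn.
apply: H => k; apply: le_lt_trans ad.
rewrite (_ : _ - _ = (a *+ (k == ord0)) *: delta_mx ord0 ord0).
  rewrite enormZ enorm_delta mulr1.
  by case: eqP => _ /=; [rewrite mulr1n gtr0_norm|rewrite mulr0n normr0 ltW].
apply/colP => i; rewrite !mxE.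
have [->|ik] := eqVneq i k; last first.
  rewrite /= !mulr0n subrr; have [k0|k0] := eqVneq k ord0; last by rewrite mul0r.
  by rewrite -k0 (negbTE ik) mulr0.
rewrite !mulr1n; case: eqVneq => _; first by rewrite subr0 mulr1n mulr1.
by rewrite subrr mulr0n mul0r.
Qed.

Lemma G_linear a : 0 < a -> G a = tau 1 + (G 1 - tau 1) * a.
Proof.
move=> a0; have := @cauchy_usc R (fun x => G x - tau 1) _ _ a a0.
move=> <-; first by rewrite addrC subrK.
  by move=> x y x0 y0; have := G_additive x0 y0 => E; lra.
have [d d0 H] := G_near0 ltr01; exists d => // x x0 xd.
by rewrite ltrBlDl; exact: H.
Qed.


Let origin := poly_hull0 (fun _ : 'I_0 => 0 : V).
Let O := Psi origin.

(** Adds the generator [x] to a family; nested uses build segments, triangles and diamonds. *)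
Definition ext (I : finType) (x : V) (w : I -> V) (o : option I) : V :=
  if o is Some i then w i else x.

(** The hyperplane [h = 0] meets the segment from [- y] to [y] at the origin, so the section is the
    hull of [w] and each half loses one of the two generators. *)
Lemma Psi_split (I : finType) (w : I -> V) h y : 0 < dot h y ->
  (forall i, dot h (w i) = 0) ->
  Psi (poly_hull0 (ext y (ext (- y) w))) =
  Psi (poly_hull0 (ext y w)) + Psi (poly_hull0 (ext (- y) w)) - Psi (poly_hull0 w).
Proof.
move=> hy hw; pose v := ext y (ext (- y) w).
have := @hull0_cut_edge _ _ _ v h None (Some None) (dot h y) (dot h y) hy hy erefl.
rewrite dotNr => /(_ erefl).
rewrite [X in let m := X in _](_ : _ = 0); last by rewrite /= scalerN subrr.
have vh i : i != None -> i != Some None -> dot h (v i) = 0.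
  by case: i => [[i|]|]// _ _; exact: hw.
move=> /(_ vh) /= [c1 c2 c0].
suff E : Psi (poly_hull0 (ext y w)) + Psi (poly_hull0 (ext (- y) w)) =
    Psi (poly_hull0 v) + Psi (poly_hull0 w) by rewrite E addrK.
apply: (valuation_cut (h := h) Psi_val) => x.
- rewrite -[polytope_set (poly_hull0 v) x /\ _]/((_ `&` [set x | 0 <= dot h x]) x) c1.
  rewrite /= (@hull0_eq0 _ _ _ _ _ (ext y w))//.
    by move=> [[i|]|]; [right; exists (Some i)|left|right; exists None].
  by move=> [i|]; right; [exists (Some (Some i))|exists None].
- rewrite -[polytope_set (poly_hull0 v) x /\ _]/((_ `&` [set x | dot h x <= 0]) x) c2.
  rewrite /= (@hull0_eq0 _ _ _ _ _ (ext (- y) w))//.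
    by move=> [[i|]|]; [right; exists (Some i)|right; exists None|left].
  by move=> [i|]; right; [exists (Some (Some i))|exists (Some None)].
- rewrite -[polytope_set (poly_hull0 v) x /\ _]/((_ `&` [set x | dot h x = 0]) x) c0.
  rewrite /= (@hull0_eq0 _ _ _ _ _ w)//.
    by move=> [[i|]|]; [right; exists i|left|left].
  by move=> i; right; exists (Some (Some i)).
Qed.

Local Notation none := (fun _ : 'I_0 => 0 : V).

Lemma Psi_ray x : x != 0 -> Psi (poly_hull0 (ext x none)) = tau 1.
Proof.
move=> /cV0Pn[i xi]; rewrite -(@Psi_lower _ x)//; last first.
  exists ((x i ord0)^-1 *: delta_mx ord0 i).
  rewrite -scalemxAl -rowE; apply/matrixP => a b; rewrite !ord1.
  by rewrite mxE [X in _ * X]mxE mulVf// mxE.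
congr Psi; apply: poly_hull0_eq0 => [[[]|]//|k]; right.
  by exists ord0; apply/colP => k; rewrite mxE.
by exists None; apply/colP => a; rewrite mxE ord1.
Qed.

Let e0 : V := delta_mx ord0 ord0.
Let e1 : V := delta_mx (lift ord0 ord0) ord0.

(** A quarter of the diamond is a triangle. For [n > 2] it has lower dimension and [c = 0]; for
    [n = 2] it is a full simplex of determinant [s0 * s1], and [G_linear] gives [c]. *)
Lemma Psi_quarter : exists c, forall s0 s1, s0 != 0 -> s1 != 0 ->
  Psi (poly_hull0 (ext (s0 *: e0) (ext (s1 *: e1) none))) = tau 1 + c * `|s0 * s1|.
Proof.
pose D s0 s1 : 'M[R]_2 := diag_mx (\row_k if k == ord0 then s0 else s1).
have detD s0 s1 : \det (D s0 s1) = s0 * s1.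
  by rewrite det_diag !big_ord_recl big_ord0 mulr1 !mxE.
pose U s0 s1 : 'M[R]_(n, 2) := pid_mx 2 *m D s0 s1.
have UE s0 s1 : poly_hull0 (ext (s0 *: e0) (ext (s1 *: e1) none)) = simplex_mx (U s0 s1).
  have c0 : col ord0 (U s0 s1) = s0 *: e0.
    by apply/colP => -[[|[|i]] hi]; rewrite /U mul_mx_diag !mxE /=
      ?mulr1 ?mul1r ?mulr0 ?mul0r.
  have c1 : col (lift ord0 ord0) (U s0 s1) = s1 *: e1.
    by apply/colP => -[[|[|i]] hi]; rewrite /U mul_mx_diag !mxE /=
      ?mulr1 ?mul1r ?mulr0 ?mul0r.
  apply: poly_hull0_eq0 => [[[[]|]|]//|k]; right.
  - by exists (lift ord0 ord0); rewrite c1.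
  - by exists ord0; rewrite c0.
  - case: (unliftP ord0 k) => [i ->|->]; last by exists None; rewrite c0.
    by rewrite ord1; exists (Some None); rewrite c1.
have UI s0 s1 : s0 != 0 -> s1 != 0 -> left_invertible (U s0 s1).
  move=> s00 s10; apply: left_invertibleM.
    by exists (pid_mx 2); rewrite pid_mx_id// pid_mx_1.
  by apply: left_invertible_unit; rewrite unitmxE detD unitfE mulf_neq0.
have [n2|n2] := ltnP 2 n.
  exists 0 => s0 s1 s00 s10; rewrite UE mul0r addr0 Psi_lower ?tau_const//.
  exact: UI.
pose W s0 s1 : 'M[R]_n :=
  diag_mx (\row_i if i == ord0 then s0 else if i == lift ord0 ord0 then s1 else 1).
have detW s0 s1 : \det (W s0 s1) = s0 * s1.
  by rewrite det_diag 2!big_ord_recl big1 ?mulr1 => [|i _]; rewrite !mxE.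
exists (G 1 - tau 1) => s0 s1 s00 s10.
have s010 : s0 * s1 != 0 by rewrite mulf_neq0.
have uW : W s0 s1 \in unitmx by rewrite unitmxE detW unitfE.
rewrite -G_linear ?normr_gt0// G_norm// -detW -Psi_full//; congr Psi.
have c0 : col ord0 (W s0 s1) = s0 *: e0.
  by apply/colP => -[[|[|i]] hi]; rewrite !mxE /= ?mulr1 ?mulr0.
have c1 : col (lift ord0 ord0) (W s0 s1) = s1 *: e1.
  by apply/colP => -[[|[|i]] hi]; rewrite !mxE /= ?mulr1 ?mulr0.
apply: poly_hull0_eq0 => [[[[]|]|]//|k]; right.
- by exists (lift ord0 ord0); rewrite c1.
- by exists ord0; rewrite c0.
- case: (unliftP ord0 k) => [i ki|->]; last by exists None; rewrite c0.
  exists (Some None); rewrite -[RHS]c1; congr col; apply: val_inj; rewrite ki /=.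
  have := ltn_ord k; rewrite ki /= => /leq_trans/(_ n2).
  by case: (nat_of_ord i) => [|[]].
Qed.

Lemma tau_origin : tau 1 = O.
Proof.
apply/eqP; rewrite eq_le; apply/andP; split; apply/ler_addgt0Pr => e e_gt0.
  have [d d0 H] := usc_hull0 (fun _ : 'I_1 => 0 : V) usc e_gt0.
  (* The origin is written with one zero generator, to be indexed like the segment shrinking to
     it. *)
  have -> : O = Psi (poly_hull0 (fun _ : 'I_1 => 0 : V)).
    by congr Psi; apply: poly_hull0_eq0 => [[]//|k]; left.
  have x0 : (d / 2) *: e0 != 0.
    rewrite scaler_eq0 negb_or gt_eqF ?divr_gt0//=; apply/cV0Pn; exists ord0.
    by rewrite mxE !eqxx oner_eq0.
  rewrite -(Psi_ray x0) ltW//.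
  have -> : poly_hull0 (ext ((d / 2) *: e0) none) = poly_hull0 (fun _ : 'I_1 => (d / 2) *: e0).
    by apply: poly_hull0_eq0 => [[[]|]//|k]; right; [exists ord0|exists None].
  apply: H => _; rewrite subr0 enormZ enorm_delta mulr1 gtr0_norm ?divr_gt0//; lra.
rewrite leNgt; apply/negP => Oe.
have [c cE] := Psi_quarter.
have dot00 : dot e0 e0 = 1 by rewrite dot_delta mxE !eqxx.
have dot11 : dot e1 e1 = 1 by rewrite dot_delta mxE !eqxx.
have dot10 : dot e1 e0 = 0 by rewrite dot_delta mxE.
have dot01 : dot e0 e1 = 0 by rewrite dot_delta mxE.
have e0n0 : e0 != 0 by apply/cV0Pn; exists ord0; rewrite mxE !eqxx oner_eq0.
have e1n0 : e1 != 0.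
  by apply/cV0Pn; exists (lift ord0 ord0); rewrite mxE !eqxx oner_eq0.
have segE x y : 0 < dot x y -> y != 0 ->
    Psi (poly_hull0 (ext y (ext (- y) none))) = tau 1 + tau 1 - O.
  move=> xy y0; rewrite (@Psi_split _ _ x)//; last by case.
  by rewrite !Psi_ray ?oppr_eq0.
have swap (x y : V) : poly_hull0 (ext y (ext x none)) = poly_hull0 (ext x (ext y none)).
  by apply: poly_hull0_eq0 => -[[[]|]|]//; right;
    [exists None|exists (Some None)|exists None|exists (Some None)].
have halfE s t : `|s| = 1 -> 0 < t -> Psi (poly_hull0 (ext (s *: e0)
    (ext (t *: e1) (ext (- (t *: e1)) none)))) = tau 1 + (c * t) *+ 2.
  move=> s1 t0.
  have s0 : s != 0 by rewrite -normr_eq0 s1 oner_eq0.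
  have -> : poly_hull0 (ext (s *: e0) (ext (t *: e1) (ext (- (t *: e1)) none))) =
      poly_hull0 (ext (t *: e1) (ext (- (t *: e1)) (ext (s *: e0) none))).
    by apply: poly_hull0_eq0 => -[[[[]|]|]|]//; right;
      [exists (Some None)|exists None|exists (Some (Some None))
      |exists None|exists (Some (Some None))|exists (Some None)].
  rewrite (@Psi_split _ _ e1).
  - rewrite !(swap (s *: e0)) -scaleNr !cE// ?oppr_eq0 ?gt_eqF// Psi_ray.
      rewrite mulrN normrN normrM s1 mul1r gtr0_norm// mulr2n; ring.
    by rewrite scaler_eq0 negb_or s0.
  - by rewrite dotZr dot11 mulr1.
  - by move=> [[]|]//; rewrite dotZr dot10 mulr0.
(* The two halves meet in a segment of value [2 tau 1 - O], whence [2 (tau 1 + 2 c t) - (2 tau 1 -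
   O) = O + 4 c t]. *)
have diamondE t : 0 < t -> Psi (poly_hull0 (ext e0 (ext (- e0)
    (ext (t *: e1) (ext (- (t *: e1)) none))))) = O + (c * t) *+ 4.
  move=> t0; rewrite (@Psi_split _ _ e0) ?dot00//; last first.
    by move=> [[[]|]|]//=; rewrite ?dotNr dotZr dot01 ?mulr0 ?oppr0.
  have := halfE 1 t; rewrite scale1r normr1 => ->//.
  have := halfE (-1) t; rewrite scaleN1r normrN1 => ->//.
  rewrite (segE e1) ?dotZr ?dot11 ?mulr1// ?scaler_eq0 ?negb_or ?gt_eqF//.
  rewrite (_ : (c * t) *+ 4 = (c * t) *+ 2 + (c * t) *+ 2) -?mulrnDr//; ring.
have Ot : 0 < O - tau 1 by rewrite subr_gt0 (le_lt_trans _ Oe)// lerDl ltW.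
have c8 : 0 < 8 * (`|c| + 1) by rewrite mulr_gt0// ltr_wpDl.
have gap : 0 < (O - tau 1) / 2 by rewrite divr_gt0.
(* The two zero generators give the limit segment the index type of the diamond. *)
have [d d0 H] := usc_hull0 (ext e0 (ext (- e0) (ext 0 (ext 0 none)))) usc gap.
have seg0 : Psi (poly_hull0 (ext e0 (ext (- e0) (ext 0 (ext 0 none))))) =
    tau 1 + tau 1 - O.
  rewrite -(segE e0 e0) ?dot00//; congr Psi.
  apply: poly_hull0_eq0; first by move=> [[[[[]|]|]|]|]//;
    [left|left|right; exists (Some None)|right; exists None].
  by move=> [[[]|]|]//; right; [exists (Some None)|exists None].
(* The second bound gives [4 |c| t <= (O - tau 1) / 2], so [O + 4 c t] exceeds the value
   [2 tau 1 - O + (O - tau 1) / 2] allowed by upper semicontinuity. *)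
pose t := Num.min (d / 2) ((O - tau 1) / (8 * (`|c| + 1))).
have t0 : 0 < t by rewrite lt_min !divr_gt0.
have td : t < d.
  by apply: (@le_lt_trans _ _ (d / 2)); [rewrite ge_min lexx|lra].
have tc : t * (8 * (`|c| + 1)) <= O - tau 1.
  by rewrite -ler_pdivlMr// ge_min lexx orbT.
have := H (ext e0 (ext (- e0) (ext (t *: e1) (ext (- (t *: e1)) none)))).
rewrite diamondE// seg0 => /(_ _)/wrap[].
  move=> [[[[[]|]|]|]|]//=; rewrite ?subrr ?subr0 ?enorm0// ?enormN enormZ enorm_delta;
    by rewrite mulr1 gtr0_norm.
have : - (`|c| * t) <= c * t.
  by rewrite lerNl -mulNr ler_pM2r// -normrN ler_norm.
rewrite -mulr_natr; nra.
Qed.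

Theorem simplex_values : exists c,
  (forall j (U : 'M[R]_(n, j)), (j < n)%N -> left_invertible U ->
    Psi (simplex_mx U) = O) /\
  (forall U : 'M[R]_n, U \in unitmx -> Psi (simplex_mx U) = O + c * `|\det U|).
Proof.
exists (G 1 - tau 1); split=> [[|j] U jn iU|U uU].
- by congr Psi; apply: poly_hull0_eq0 => -[].
- by rewrite Psi_lower// tau_const// tau_origin.
- have d0 : \det U != 0 by rewrite -unitfE -unitmxE.
  by rewrite Psi_full// -G_norm// G_linear ?normr_gt0// tau_origin.
Qed.

End simplex_values.

(** * Affine functions of volume, and the characterisation *)

Section linear_combinations.
Context {R : realType} {n : nat}.
Implicit Types (Psi : polytope0 R n -> R) (P Q : polytope0 R n).

Lemma euler_char1 P : euler_char P = 1.
Proof.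
by rewrite /euler_char asboolT//; exists 0; exact: polytope_origin.
Qed.

Lemma affine_volume_usc c0 cn :
  upper_semicontinuous (fun P : polytope0 R n => c0 + cn * volume P).
Proof.
move=> P a Pa; apply/near_polytope0P.
(* The summand 1 keeps the denominator positive when [cn = 0]. *)
pose e := (a - (c0 + cn * volume P)) / (`|cn| + 1).
have cn1 : 0 < `|cn| + 1 by rewrite ltr_wpDl.
have e0 : 0 < e by rewrite divr_gt0// subr_gt0.
have ea : (`|cn| + 1) * e = a - (c0 + cn * volume P) by rewrite mulrC divfK// gt_eqF.
have [d1 d10 H1] := volume_usc P e0; have [d2 d20 H2] := volume_lsc P e0.
exists (Num.min d1 d2) => [|Q]; first by rewrite lt_min d10.
rewrite lt_min => /andP[/H1 Q1 /H2 Q2].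
have : cn * (volume Q - volume P) <= `|cn| * e.
  apply: le_trans (ler_norm _) _; rewrite normrM ler_wpM2l// ler_norml.
  by apply/andP; split; lra.
lra.
Qed.

Lemma valuation_sub Psi1 Psi2 c0 c :
  is_valuation Psi1 -> is_valuation Psi2 ->
  is_valuation (fun P => Psi1 P - c0 - c * Psi2 P).
Proof.
move=> v1 v2 P Q PU PI PUE PIE.
by have := v1 _ _ _ _ PUE PIE; have := v2 _ _ _ _ PUE PIE => E2 E1; nra.
Qed.

End linear_combinations.

Theorem corollary1p2 (R : realType) (n : nat) (hn : (2 <= n)%N)
    (Psi : polytope0 R n -> R) :
  [/\ upper_semicontinuous Psi, SL_invariant Psi & is_valuation Psi] <->
  exists c0 cn : R, forall P : polytope0 R n,
    Psi P = c0 * euler_char P + cn * volume P.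
Proof.
split=> [[usc SL val]|[c0 [cn PsiE]]]; last first.
  (* All these polytopes contain 0, so the Euler characteristic is constantly 1. *)
  have {}PsiE : Psi = (fun P => c0 + cn * volume P).
    by apply/funext => P; rewrite PsiE euler_char1 mulr1.
  rewrite PsiE; split; first exact: affine_volume_usc.
    by move=> A P detA; rewrite (volume_SL P detA).
  move=> P Q PU PI PUE PIE.
  by have := volume_valuation PUE PIE => E; nra.
case: n hn Psi usc SL val => [//|[//|n]] _ Psi usc SL val.
have [c [cl cf]] := simplex_values usc SL val.
have vusc : upper_semicontinuous (fun P : polytope0 R n.+2 => volume P).
  have := @affine_volume_usc R n.+2 0 1; congr upper_semicontinuous.
  by apply/funext => P; rewrite add0r mul1r.
(* Applying the same result to volume replaces the computation of simplex volumes; [k] is the volume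
   of the standard simplex. *)
have [k [kl kf]] := simplex_values vusc (@volume_SL R n.+2) (@volume_valuation R n.+2).
set O := poly_hull0 _ in cl cf kl kf.
have VO : volume O = 0.
  apply: (@volume_hyperplane _ _ O (delta_mx ord0 ord0)).
    by apply/cV0Pn; exists ord0; rewrite mxE !eqxx oner_eq0.
  by move=> x [w [_ _ ->]]; rewrite big_ord0 dot0r.
have k0 : 0 < k.
  have := kf 1%:M (unitmx1 _ _); rewrite det1 normr1 mulr1 VO add0r => <-.
  have := @volume_standard_simplex_gt0 R n.+2; congr (0 < volume (hull0 _)).
  by apply/funext => i; apply/colP => a; rewrite !mxE andbT.
(* [Psi O] is the common value on lower-dimensional simplices, and [c / k] makes the determinant
   terms cancel on full ones. *)
exists (Psi O), (c / k) => P; rewrite euler_char1 mulr1.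
apply/eqP; rewrite -subr_eq0 opprD addrA; apply/eqP.
apply: (valuation_vanishing (Phi := fun P => Psi P - Psi O - c / k * volume P)).
  exact: valuation_sub (@volume_valuation R n.+2).
move=> j u g gu.
pose U : 'M[R]_(n.+2, j) := \matrix_(a, b) u b a ord0.
have -> : poly_hull0 u = simplex_mx U.
  by apply: poly_hull0_eq0 => b; right; exists b; apply/colP => a; rewrite !mxE.
(* The dual vectors are the rows of a left inverse, which also forces [j <= n.+2]. *)
have iU : left_invertible U.
  exists (\matrix_(a, b) g a b ord0); apply/matrixP => a b.
  by rewrite !mxE -gu; apply: eq_bigr => i _; rewrite !mxE.
have := left_invertible_leq iU; rewrite leq_eqVlt => /orP[/eqP jn|jn].
  subst j; have uU : U \in unitmx.
    by have [F FU] := iU; have [] := mulmx1_unit FU.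
  rewrite cf// kf// VO add0r; field; exact: lt0r_neq0.
by rewrite cl// kl// VO mulr0 subr0 subrr.
Qed.
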